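(* Let $M$ be a separable $\mathrm{II}_1$ factor and $n\in\mathbb N$. If $\mathcal G(M)<n/2$, then $M$ is generated (as a von Neumann algebra) by $n+1$ hermitian (self-adjoint) elements.
   Context: Let $M$ be a $\mathrm{II}_1$ factor with its faithful normal trace $\tau$, normalised by $\tau(1)=1$. Let $\mathcal P(M)$ be the collection of all finite sets of mutually orthogonal projections in $M$ which sum to $1$. For $x\in M$ and $P\in\mathcal P(M)$ put $$\mathcal I(x;P)=\sum_{p,q\in P,\ pxq\neq 0}\tau(p)\tau(q).$$ For a finite subset $X\subset M$ put $\mathcal I(X;P)=\sum_{x\in X}\mathcal I(x;P)$ and $\mathcal I(X)=\inf_{P\in\mathcal P(M)}\mathcal I(X;P)$. $W^*(X)$ denotes the von Neumann algebra generated by $X$ (it is not automatically assumed to contain the identity of $M$). The generator invariant is $$\mathcal G(M)=\inf\{\mathcal I(X)\ :\ X\subset M\text{ finite},\ W^*(X)=M\},$$ with $\mathcal G(M)=\infty$ if $M$ is not finitely generated. *)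

(* Defs.v *)
From mathcomp Require Import all_boot all_order all_algebra.
From mathcomp Require Import all_classical all_reals all_analysis.
From mathcomp Require Import complex sesquilinear.
Set Implicit Arguments.
Unset Strict Implicit.
Unset Printing Implicit Defensive.
Import Order.TTheory GRing.Theory Num.Theory numFieldNormedType.Exports.
Local Open Scope classical_set_scope.
Local Open Scope complex_scope.
Local Open Scope ring_scope.

Section Operators.
Context {R : realType} {H : completeNormedModType R[i]}.
Implicit Types (x y p q v : H -> H) (A X P M : set (H -> H)).

(* Operators are plain functions [H -> H], with the pointwise vector space
   structure; the product is composition and the unit is [idfun]. *)
Definition bounded_op : set (H -> H) :=
  [set x | linear x /\
     exists k : R[i], forall u : H, `|x u| <= k * `|u|].

Variable dot : {dot H for (@Num.conj R[i])}.

(* [H] is a Hilbert space: its norm, for which it is complete, is the one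
   coming from [dot], which is linear in its first argument and conjugate
   linear in its second one. *)
Definition hilbert_space := forall u : H, `|u| ^+ 2 = dot u u.

Definition is_adjoint x y := forall u w : H, dot (x u) w = dot u (y w).

(* The default value is never used when [x] is a bounded operator on a
   Hilbert space, since the adjoint then exists (and it is always unique). *)
Definition adj x : H -> H := xget (fun=> 0) [set y | is_adjoint x y].

Definition selfadjoint x := adj x = x.

Definition projection : set (H -> H) :=
  [set p | [/\ bounded_op p, p \o p = p & selfadjoint p]].

(* Order on self-adjoint operators: [y - x] is positive. *)
Definition le_op x y := forall u : H, dot (x u) u <= dot (y u) u.

(* Closure in the weak operator topology of [B(H)]: the basic neighbourhoods
   of [x] are given by a finite list of pairs of vectors and some [e > 0]. *)
Definition wot_closure A : set (H -> H) :=
  [set x | bounded_op x /\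
     forall (s : seq (H * H)) (e : R), 0 < e ->
       exists2 y, A y & forall uw, uw \in s ->
         `|dot (x uw.1) uw.2 - dot (y uw.1) uw.2| < e%:C].

(* Weakly closed *-subalgebras of [B(H)], not assumed to contain [idfun]. *)
Record weakly_closed_star_algebra A : Prop := {
  wcsa_bounded : A `<=` bounded_op ;
  wcsa_zero : A (fun=> 0) ;
  wcsa_linear : forall (a : R[i]) x y, A x -> A y -> A (a *: x + y) ;
  wcsa_mul : forall x y, A x -> A y -> A (x \o y) ;
  wcsa_adj : forall x, A x -> A (adj x) ;
  wcsa_closed : wot_closure A `<=` A }.

Definition vonNeumann_algebra M := weakly_closed_star_algebra M /\ M idfun.

(* [W*(X)] for [X] a set of bounded operators. *)
Definition Wstar X : set (H -> H) :=
  \bigcap_(A in [set A | weakly_closed_star_algebra A /\ X `<=` A]) A.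

Definition factor M :=
  [/\ vonNeumann_algebra M,
      (idfun : H -> H) <> (fun=> 0) &
      forall x, M x -> (forall y, M y -> x \o y = y \o x) ->
        exists a : R[i], x = a *: (idfun : H -> H)].

Definition mvn_equiv M p q :=
  exists v, [/\ M v, adj v \o v = p & v \o adj v = q].

Definition finite_projection M p :=
  forall q, M q -> projection q -> le_op q p -> mvn_equiv M p q -> q = p.

Definition abelian_projection M p :=
  forall x y, M x -> M y ->
    (p \o x \o p) \o (p \o y \o p) = (p \o y \o p) \o (p \o x \o p).

Definition II1_factor M :=
  [/\ factor M,
      finite_projection M idfun &
      forall p, M p -> projection p -> abelian_projection M p ->
        p = (fun=> 0)].

(* Elements of the predual, as functions on [M]: the functionals
   [x |-> \sum_k <x xi_k, eta_k>] with square-summable [xi] and [eta]. Their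
   values outside [M] are irrelevant. *)
Definition ultraweakly_continuous M (phi : (H -> H) -> R[i]) :=
  exists xi eta : nat -> H,
    [/\ exists b : R[i], forall N : nat, \sum_(k < N) `|xi k| ^+ 2 <= b,
        exists b : R[i], forall N : nat, \sum_(k < N) `|eta k| ^+ 2 <= b &
        forall x, M x ->
          (fun N : nat => \sum_(k < N) dot (x (xi k)) (eta k) : R[i]^o) @ \oo
            --> (phi x : R[i]^o)].

(* The predual is separable for the norm dual to the operator norm. *)
Definition separable_vN M :=
  exists2 phi : nat -> (H -> H) -> R[i],
    forall k, ultraweakly_continuous M (phi k) &
    forall psi, ultraweakly_continuous M psi ->
      forall e : R, 0 < e -> exists k, forall x, M x ->
        (forall u : H, `|x u| <= `|u|) -> `|psi x - phi k x| <= e%:C.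

Definition selfadjoint_part M : set (H -> H) :=
  [set x | M x /\ selfadjoint x].

Definition directed (D : set (H -> H)) :=
  D !=set0 /\ forall x y, D x -> D y ->
    exists z, [/\ D z, le_op x z & le_op y z].

Definition is_lub_op M (D : set (H -> H)) x :=
  [/\ selfadjoint_part M x, forall y, D y -> le_op y x &
      forall z, selfadjoint_part M z -> (forall y, D y -> le_op y z) ->
        le_op x z].

(* Only the values of [tau] on [M] matter. In [R[i]], [a <= b] means that
   [b - a] is a nonnegative real number. *)
Record faithful_normal_tracial_state M (tau : (H -> H) -> R[i]) : Prop := {
  tr_linear : forall (a : R[i]) x y, M x -> M y ->
    tau (a *: x + y) = a * tau x + tau y ;
  tr_tracial : forall x y, M x -> M y -> tau (x \o y) = tau (y \o x) ;
  tr_positive : forall x, M x -> 0 <= tau (adj x \o x) ;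
  tr_faithful : forall x, M x -> tau (adj x \o x) = 0 -> x = (fun=> 0) ;
  tr_normal : forall D x, D `<=` selfadjoint_part M -> directed D ->
    is_lub_op M D x -> supremums (tau @` D) (tau x) ;
  tr_unit : tau idfun = 1 }.

Definition projection_partitions M : set (set (H -> H)) :=
  [set P | [/\ finite_set P,
               P `<=` M `&` projection,
               forall p q, P p -> P q -> p <> q -> p \o q = (fun=> 0) &
               \sum_(p \in P) p = idfun]].

Section Invariant.
Variables (M : set (H -> H)) (tau : (H -> H) -> R[i]).

(* The trace of a projection of [M] is real. *)
Definition rtr p : R := complex.Re (tau p).

Definition Ielt x P : R :=
  \sum_(pq \in [set pq : (H -> H) * (H -> H) |
                 [/\ P pq.1, P pq.2 & pq.1 \o x \o pq.2 <> (fun=> 0)]])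
    (rtr pq.1 * rtr pq.2).

Definition Ipart X P : R := \sum_(x \in X) Ielt x P.

Definition Iset X : \bar R :=
  ereal_inf [set (Ipart X P)%:E | P in projection_partitions M].

(* [ereal_inf set0 = +oo]: the case where [M] is not finitely generated. *)
Definition generator_invariant : \bar R :=
  ereal_inf [set Iset X |
    X in [set X | [/\ finite_set X, X `<=` M & Wstar X = M]]].

End Invariant.
End Operators.

(* Main.v *)
(* A partition with intersection sum below n/2 is refined until all but a small
   part of it consists of m mutually equivalent projections, the copies of a
   projection e of small trace, the remaining pieces being equivalent to
   subprojections of e. The generators then become matrices having fewer than
   about n m^2 / 2 nonzero entries altogether. Moving these entries by the
   partial isometries implementing the equivalences, one can put them all in
   the roughly n m^2 / 2 places strictly above the diagonals of n matrices,
   completed to self-adjoint ones; some of the places hold the partial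
   isometries themselves. One more self-adjoint element, diagonal with distinct
   nonzero eigenvalues, generates the diagonal projections and makes it possible
   to read off all the entries.

   Equivalences between projections come from the comparison theorem. Partial
   isometries are obtained by polar decomposition as strong limits of Newton's
   iteration, and comparability from a partial isometry which is maximal for
   extension and exists because the trace bounds increasing sequences. *)
Require Import Defs.
From HB Require Import structures.
From mathcomp Require Import all_boot all_order all_algebra.
From mathcomp Require Import all_classical all_reals all_analysis.
From mathcomp Require Import complex sesquilinear.
From mathcomp Require Import zify ring lra.
Set Implicit Arguments.
Unset Strict Implicit.
Unset Printing Implicit Defensive.
Import Order.TTheory GRing.Theory Num.Theory numFieldNormedType.Exports.
Local Open Scope classical_set_scope.
Local Open Scope complex_scope.
Local Open Scope ring_scope.

(** * Hilbert space preliminaries *)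

(** The count works because the hypothesis is strict. Let [eps] be the trace of [e], [s] the number
    of pieces of the partition and [m] the number of copies of [e], so that [m * eps] lies between
    [1 - s * eps] and 1. A nonzero [p x q] accounts for at most [tr p * tr q / eps^2] entries
    between copies, and the remaining pieces add a number of entries linear in [m]. About
    [I / eps^2] entries must therefore fit into [n (m - 1) (m - 2) / 2] places, where [m] is about
    [1 / eps], and the gap between [I] and [n / 2] absorbs the terms of lower order once [eps] is
    small. Arbitrarily small traces exist because a projection that could not be halved would be
    minimal, hence abelian. Spectral theory is replaced by positivity of quadratic forms and strong
    limits of sequences of contractions. The factor enters through [star_rep] and [tracial_factor],
    as an abstract algebra in which ring identities are available. Recovering the old generators
    from the new ones is purely algebraic. *)

Section ComplexParts.
Variable R : realType.
Implicit Types (z : R[i]) (a : R).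

Lemma Re_realM a z : complex.Re (a%:C * z) = a * complex.Re z.
Proof. by case: z => x y /=; ring. Qed.

Lemma Re_conj z : complex.Re (Num.conj z) = complex.Re z.
Proof. by case: z. Qed.

Lemma Re_Ni z : complex.Re (- 'i * z) = complex.Im z.
Proof. by case: z => x y /=; ring. Qed.

Lemma conj_Ni : Num.conj (- 'i : R[i]) = 'i.
Proof. by rewrite (_ : Num.conj _ = conjc (- 'i)) //= oppr0 opprK. Qed.

Lemma complex_ext z z' : complex.Re z = complex.Re z' ->
  complex.Re (- 'i * z) = complex.Re (- 'i * z') -> z = z'.
Proof. by rewrite !Re_Ni; case: z => x y; case: z' => x' y' /= -> ->. Qed.

Lemma ge0_Re z : 0 <= z -> z = (complex.Re z)%:C.
Proof. by move=> z0; rewrite RRe_real // ger0_real. Qed.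

End ComplexParts.

Section RealDot.
Context {R : realType} {H : completeNormedModType R[i]}.
Variable dot : {dot H for (@Num.conj R[i])}.
Implicit Types (u v w : H) (a : R).

(** Estimates are made with the real part, in the ordered field [R]. Nothing is lost: by [Im_dot]
    the imaginary part is a real part too, after multiplying the first vector by [- 'i]. *)
Definition rdot u w : R := complex.Re (dot u w).
Definition nsq u : R := rdot u u.

Lemma rdotC u w : rdot u w = rdot w u.
Proof.
by rewrite /rdot (hermC dot u w) /= expr0 mul1r Re_conj.
Qed.

Lemma rdotDl u v w : rdot (u + v) w = rdot u w + rdot v w.
Proof. by rewrite /rdot linearDl raddfD. Qed.

Lemma rdotNl u w : rdot (- u) w = - rdot u w.
Proof. by rewrite /rdot linearNl raddfN. Qed.

Lemma rdotBl u v w : rdot (u - v) w = rdot u w - rdot v w.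
Proof. by rewrite rdotDl rdotNl. Qed.

Lemma rdotDr u v w : rdot w (u + v) = rdot w u + rdot w v.
Proof. by rewrite rdotC rdotDl !(rdotC _ w). Qed.

Lemma rdotNr u w : rdot w (- u) = - rdot w u.
Proof. by rewrite rdotC rdotNl rdotC. Qed.

Lemma rdotBr u v w : rdot w (u - v) = rdot w u - rdot w v.
Proof. by rewrite rdotDr rdotNr. Qed.

Lemma rdot0l u : rdot 0 u = 0.
Proof. by rewrite /rdot linear0l raddf0. Qed.

Lemma rdot0r u : rdot u 0 = 0.
Proof. by rewrite rdotC rdot0l. Qed.

Lemma rdotZl a u w : rdot (a%:C *: u) w = a * rdot u w.
Proof.
by rewrite /rdot linearZl_LR /= Re_realM.
Qed.

Lemma rdotZr a u w : rdot w (a%:C *: u) = a * rdot w u.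
Proof. by rewrite rdotC rdotZl rdotC. Qed.

Lemma Im_dot u w : complex.Im (dot u w) = rdot ((- 'i) *: u) w.
Proof.
by rewrite /rdot linearZl_LR /= Re_Ni.
Qed.

Lemma dot_nsq u : dot u u = (nsq u)%:C.
Proof.
exact/ge0_Re/(dnorm_ge0 dot).
Qed.

Lemma nsq_ge0 u : 0 <= nsq u.
Proof. by rewrite -lecR -dot_nsq; exact: (dnorm_ge0 dot). Qed.

Lemma nsq0 : nsq 0 = 0. Proof. exact: rdot0l. Qed.

Lemma nsq_eq0 u : nsq u = 0 -> u = 0.
Proof.
by move=> h; apply/eqP; rewrite -(dnorm_eq0 dot) dot_nsq h.
Qed.

Lemma nsqD u w : nsq (u + w) = nsq u + nsq w + 2 * rdot u w.
Proof. rewrite /nsq rdotDl !rdotDr (rdotC w u); ring. Qed.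

Lemma nsqB u w : nsq (u - w) = nsq u + nsq w - 2 * rdot u w.
Proof. rewrite /nsq rdotBl !rdotBr (rdotC w u); ring. Qed.

Lemma nsqN u : nsq (- u) = nsq u.
Proof. by rewrite /nsq rdotNl rdotNr opprK. Qed.

Lemma nsqZ a u : nsq (a%:C *: u) = a ^+ 2 * nsq u.
Proof. by rewrite /nsq rdotZl rdotZr mulrA. Qed.

Lemma nsqNi u : nsq ((- 'i) *: u) = nsq u.
Proof.
rewrite /nsq /rdot linearZl_LR linearZr_LR /= conj_Ni mulrA mulNr.
by rewrite -expr2 sqr_i opprK mul1r.
Qed.

Lemma nsqD_le u w : nsq (u + w) <= 2 * nsq u + 2 * nsq w.
Proof.
have := nsq_ge0 (u - w); rewrite nsqB nsqD; lra.
Qed.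

Lemma rdot_sqr_le u w : (rdot u w) ^+ 2 <= nsq u * nsq w.
Proof.
have [->|w0] := eqVneq w 0; first by rewrite rdot0r nsq0 mulr0 expr0n.
have wgt0 : 0 < nsq w.
  by rewrite lt_def nsq_ge0 andbT; apply: contra_neq w0; exact: nsq_eq0.
have := nsq_ge0 ((nsq w)%:C *: u - (rdot u w)%:C *: w).
rewrite nsqB !nsqZ rdotZl rdotZr => h.
have : 0 <= nsq w * (nsq u * nsq w - (rdot u w) ^+ 2) by move: h; nra.
by rewrite pmulr_rge0 // subr_ge0.
Qed.

Lemma rdot_ext u w : (forall v, rdot u v = rdot w v) -> u = w.
Proof.
move=> h; apply/eqP; rewrite -subr_eq0; apply/eqP/nsq_eq0.
by rewrite /nsq rdotBl h subrr.
Qed.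

Lemma dot_ext_r u w : (forall v, rdot v u = rdot v w) -> u = w.
Proof. by move=> h; apply: rdot_ext => v; rewrite rdotC h rdotC. Qed.

(** Norm convergence, stated with squares to avoid square roots; strong operator limits are this for
    every vector. *)
Definition slim (s : nat -> H) (l : H) :=
  forall e : R, 0 < e -> exists N, forall n, (N <= n)%N -> nsq (s n - l) < e.

Lemma slim_uniq s l l' : slim s l -> slim s l' -> l = l'.
Proof.
move=> h h'; apply/eqP; rewrite -subr_eq0; apply/eqP/nsq_eq0/eqP.
rewrite eq_le nsq_ge0 andbT; apply/ler_addgt0Pr => e e0; rewrite add0r.
have e4 : 0 < e / 4 by lra.
have [N hN] := h _ e4; have [N' hN'] := h' _ e4.
have := hN _ (leq_maxl N N'); have := hN' _ (leq_maxr N N').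
set n := maxn N N' => h1 h2.
have -> : l - l' = (s n - l') - (s n - l) by rewrite opprB [RHS]addrC addrA subrK.
by have := nsqD_le (s n - l') (- (s n - l)); rewrite nsqN; lra.
Qed.

Lemma slim_cst l : slim (fun=> l) l.
Proof. by move=> e e0; exists 0%N => n _; rewrite subrr nsq0. Qed.

Lemma slim_ext s s' l : s =1 s' -> slim s l -> slim s' l.
Proof. by move=> ss h e /h[N hN]; exists N => n /hN; rewrite ss. Qed.

Lemma slim_shift k s l : slim s l -> slim (fun n => s (n + k)%N) l.
Proof.
by move=> h e /h[N hN]; exists N => n Nn; apply: hN; exact: (leq_trans Nn (leq_addr _ _)).
Qed.

Lemma slimD s s' l l' : slim s l -> slim s' l' ->
  slim (fun n => s n + s' n) (l + l').
Proof.
move=> h h' e e0; have e4 : 0 < e / 4 by lra.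
have [N hN] := h _ e4; have [N' hN'] := h' _ e4.
exists (maxn N N') => n; rewrite geq_max => /andP[/hN h1 /hN' h2].
rewrite opprD addrACA; have := nsqD_le (s n - l) (s' n - l'); lra.
Qed.

(* The operator sequence is uniformly Lipschitz, so that strong limits can be
   composed. *)
Lemma slim_op (f : nat -> H -> H) (k : R) s l l' :
  (forall n u v, f n (u - v) = f n u - f n v) ->
  (forall n u, nsq (f n u) <= k * nsq u) ->
  slim s l -> slim (fun n => f n l) l' -> slim (fun n => f n (s n)) l'.
Proof.
move=> fB fk h h' e e0.
have K0 : 0 < `|k| + 1 by have := normr_ge0 k; lra.
have e4 : 0 < e / 4 by lra.
have e4k : 0 < e / 4 / (`|k| + 1) by apply: divr_gt0.
have [N hN] := h _ e4k; have [N' hN'] := h' _ e4.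
exists (maxn N N') => n; rewrite geq_max => /andP[/hN h1 /hN' h2].
have -> : f n (s n) - l' = f n (s n - l) + (f n l - l').
  by rewrite fB addrA subrK.
have := nsqD_le (f n (s n - l)) (f n l - l').
have : nsq (f n (s n - l)) < e / 4.
  apply: le_lt_trans (fk _ _) _; apply: (@le_lt_trans _ _ ((`|k| + 1) * nsq (s n - l))).
    by apply: ler_wpM2r; [exact: nsq_ge0 | have := ler_norm k; lra].
  by rewrite mulrC -ltr_pdivlMr.
lra.
Qed.

Lemma slim_op1 (f : H -> H) (k : R) s l :
  (forall u v, f (u - v) = f u - f v) ->
  (forall u, nsq (f u) <= k * nsq u) ->
  slim s l -> slim (fun n => f (s n)) (f l).
Proof.
by move=> fB fk h; apply: (@slim_op (fun=> f) k _ l) => //; exact: slim_cst.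
Qed.

Lemma slimZ (a : R[i]) s l : slim s l -> slim (fun n => a *: s n) (a *: l).
Proof.
apply: (@slim_op1 _ (complex.Re (`|a| ^+ 2))) => [u v|u]; first by rewrite scalerBr.
rewrite -lecR -dot_nsq dnormZ dot_nsq le_eqVlt; apply/orP; left; apply/eqP.
have : `|a| ^+ 2 \is Num.real by apply: rpredX; exact: normr_real.
by move=> /RRe_real <-; rewrite rmorphM /=.
Qed.

Lemma slimB s s' l l' : slim s l -> slim s' l' ->
  slim (fun n => s n - s' n) (l - l').
Proof.
move=> h h'; have := slimD h (slimZ (-1) h').
by rewrite scaleN1r; apply: slim_ext => n; rewrite scaleN1r.
Qed.

Lemma slim_rdot s l w : slim s l -> forall e : R, 0 < e ->
  exists N, forall n, (N <= n)%N -> `|rdot (s n) w - rdot l w| < e.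
Proof.
move=> h e e0.
have K0 : 0 < nsq w + 1 by have := nsq_ge0 w; lra.
have d0 : 0 < e ^+ 2 / (nsq w + 1) by apply: divr_gt0; rewrite ?exprn_gt0.
have [N hN] := h _ d0; exists N => n /hN; rewrite ltr_pdivlMr // => lt.
rewrite -rdotBl -(@ltr_pXn2r _ 2%N) ?nnegrE ?(ltW e0) // real_normK ?num_real //.
apply: le_lt_trans (rdot_sqr_le _ _) (le_lt_trans _ lt).
by apply: ler_wpM2l; [exact: nsq_ge0 | lra].
Qed.

Lemma slim_rdot_ge s l w (c : R) : slim s l -> (forall n, c <= rdot (s n) w) ->
  c <= rdot l w.
Proof.
move=> h hc; apply/ler_addgt0Pr => e e0.
have [N /(_ N (leqnn N))] := slim_rdot w h e0.
by rewrite ltr_norml => /andP[_]; have := hc N; lra.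
Qed.

Lemma slim_rdot_eq2 s l w s' l' w' : slim s l -> slim s' l' ->
  (forall n, rdot (s n) w = rdot (s' n) w') -> rdot l w = rdot l' w'.
Proof.
move=> h h' E; apply/eqP; rewrite -subr_eq0 -normr_le0.
apply/ler_addgt0Pr => e e0; rewrite add0r.
have e2 : 0 < e / 2 by lra.
have [N hN] := slim_rdot w h e2; have [N' hN'] := slim_rdot w' h' e2.
have := hN _ (leq_maxl N N'); have := hN' _ (leq_maxr N N').
rewrite E !ltr_norml => /andP[? ?] /andP[? ?]; rewrite ler_norml.
by apply/andP; split; lra.
Qed.

Lemma slim_rdot_le s l w (c : R) : slim s l -> (forall n, rdot (s n) w <= c) ->
  rdot l w <= c.
Proof.
move=> h hc; rewrite -lerN2 -rdotNr; apply: (slim_rdot_ge h) => n.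
by rewrite rdotNr lerN2.
Qed.

Lemma slim_rdot_eq s l w (c : R) : slim s l -> (forall n, rdot (s n) w = c) ->
  rdot l w = c.
Proof.
move=> h hc; apply/eqP; rewrite eq_le (slim_rdot_le h) ?(slim_rdot_ge h) //;
by move=> n; rewrite hc.
Qed.

(** Weak convergence is enough: [2 * rdot (s n) l <= nsq (s n) + nsq l], and the left side tends to
    [2 * nsq l]. *)
Lemma slim_nsq_le s l (c : R) : slim s l -> (forall n, nsq (s n) <= c) ->
  nsq l <= c.
Proof.
move=> h hc; apply/ler_addgt0Pr => e e0.
have h1 : slim s l := h.
suff : forall n, rdot (s n) l <= (c + nsq l) / 2.
  by move/(slim_rdot_le h); rewrite -/(nsq l); lra.
move=> n; have := nsq_ge0 (s n - l); rewrite nsqB; have := hc n; lra.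
Qed.

Hypothesis hH : hilbert_space dot.

Lemma norm_lt (u : H) (e : R) : 0 < e -> (`|u| < e%:C) = (nsq u < e ^+ 2).
Proof.
move=> e0; rewrite -(@ltr_pXn2r _ 2%N) ?nnegrE ?ler0c ?(ltW e0) //.
by rewrite hH dot_nsq -rmorphXn ltcR.
Qed.

Lemma slim_complete (s : nat -> H) :
  (forall e : R, 0 < e -> exists N, forall n, (N <= n)%N -> nsq (s n - s N) < e) ->
  exists l, slim s l.
Proof.
move=> h; suff /cauchy_cvg cs : cauchy (s @ \oo).
  exists (lim (s @ \oo)) => e e0.
  have se : (0 : R[i]) < (Num.sqrt e)%:C by rewrite ltcR sqrtr_gt0.
  have := cs; move=> /cvgrPdist_lt /(_ _ se) [N _ hN].
  exists N => n Nn; have := hN n Nn; rewrite /= distrC norm_lt ?sqrtr_gt0 //.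
  by rewrite sqr_sqrtr // ltW.
apply: cauchy_exP => e e0.
have [r r0 ->] : exists2 r : R, 0 < r & e = r%:C.
  exists (complex.Re e); last by rewrite RRe_real // gtr0_real.
  by move: e0; rewrite ltcE => /andP[_].
have r2 : 0 < r ^+ 2 by rewrite exprn_gt0.
have [N hN] := h _ r2; exists (s N); exists N => // n Nn.
by rewrite /= -ball_normE /= distrC norm_lt //; apply: hN.
Qed.

(** The bounded increasing sequence [F] is Cauchy and its increments dominate those of [s]. This
    plays the role of the strong convergence of bounded monotone sequences of operators. *)
Lemma slim_mono (s : nat -> H) (F : nat -> R) (B : R) :
  (forall n m, (n <= m)%N -> nsq (s m - s n) <= F m - F n) ->
  (forall n, F n <= B) -> exists l, slim s l.
Proof.
move=> h hB; apply: slim_complete => e e0.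
have hs : has_sup (range F).
  by split; [exists (F 0%N), 0%N | exists B => _ [n _ <-]].
have [_ [N _ <-] hN] := sup_adherent e0 hs.
exists N => n Nn; apply: le_lt_trans (h _ _ Nn) _.
have : F n <= sup (range F) by apply: ub_le_sup; [case: hs | exists n].
lra.
Qed.

(* The representing vector minimises [nsq u - 2 Re (f u)]. *)
Lemma riesz (f : H -> R[i]) (k : R) :
  (forall (a : R[i]) u v, f (a *: u + v) = a * f u + f v) ->
  (forall u, (complex.Re (f u)) ^+ 2 <= k * nsq u) ->
  exists w, forall u, f u = dot u w.
Proof.
move=> fl fk; pose g u := complex.Re (f u).
have f0 : f 0 = 0 by have := fl (-1) 0 0; rewrite scaler0 addr0 mulN1r addNr.
have gD u v : g (u + v) = g u + g v.
  by rewrite /g -[u]scale1r fl scale1r mul1r raddfD.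
have gZ (a : R) u : g (a%:C *: u) = a * g u.
  by rewrite /g -[_ *: u]addr0 fl f0 addr0 Re_realM.
pose q u := nsq u - 2 * g u.
have qlb u : - `|k| <= q u.
  have /= := fk u; rewrite -/(g u) /q => hu.
  have n0 := nsq_ge0 u.
  have h2 : (g u) ^+ 2 <= `|k| * nsq u.
    by apply: le_trans hu _; apply: ler_wpM2r => //; exact: ler_norm.
  have k0 := normr_ge0 k.
  rewrite leNgt; apply/negP => lt.
  have : (nsq u + `|k|) ^+ 2 < (2 * g u) ^+ 2.
    by rewrite ltr_pXn2r ?nnegrE //; lra.
  by have := sqr_ge0 (nsq u - `|k|); nra.
pose S := [set - q u | u in [set: H]].
have hS : has_sup S.
  split; first by exists (- q 0); exists 0.
  by exists `|k| => _ [u _ <-]; have := qlb u; lra.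
have qS u : - sup S <= q u.
  have : - q u <= sup S by apply: ub_le_sup; [case: hS | exists u].
  lra.
have ex n : exists u, q u < - sup S + n.+1%:R^-1.
  have p : 0 < n.+1%:R^-1 :> R by rewrite invr_gt0.
  have [_ [u _ <-] hu] := sup_adherent p hS.
  exists u; move: hu; set r := _^-1. lra.
have [s hs] := choice ex.
have [w hw] : exists w, slim s w.
  apply: slim_complete => e e0.
  have e4 : 0 < e / 4 by lra.
  have [N _ hN] := near_infty_natSinv_lt (PosNum e4).
  have {}hN n : (N <= n)%N -> n.+1%:R^-1 < e / 4 by move=> /hN.
  exists N => n Nn.
  have h1 := hs n; have h2 := hs N; have h3 := hN n Nn; have h4 := hN N (leqnn N).
  (* Parallelogram identity: [q (s n) + q (s N)] exceeds twice the value of [q] at the midpoint by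
     half of [nsq (s n - s N)], and the midpoint stays above the infimum. *)
  have := qS ((1/2)%:C *: (s n + s N)).
  move: h1 h2 h3 h4; rewrite /q nsqZ gZ gD nsqD nsqB.
  by set r := n.+1%:R^-1; set r' := N.+1%:R^-1; lra.
have wmin u : q w <= q u.
  have qle : q w <= - sup S.
    apply/ler_addgt0Pr => e e0.
    (* The second bound is chosen so that both [g d] and [rdot d w], the first-order terms of [q] at
       [w], are at most [e / 8] in absolute value. *)
    have d0 : 0 < Num.min (e / 4) (e ^+ 2 / (64 * (`|k| + nsq w + 1))).
      rewrite lt_min; apply/andP; split; first lra.
      apply: divr_gt0; first by rewrite exprn_gt0.
      by have := normr_ge0 k; have := nsq_ge0 w; lra.
    have [N hN] := hw _ d0.
    have e4 : 0 < e / 4 by lra.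
    have [N' _ hN'] := near_infty_natSinv_lt (PosNum e4).
    have := hN _ (leq_maxl N N'); have := hN' _ (leq_maxr N N').
    set n := maxn N N'; move=> /= h1; rewrite lt_min => /andP[h2 h3].
    have h4 := hs n.
    pose d := s n - w.
    have dE : s n = d + w by rewrite /d subrK.
    have K0 : 0 < 64 * (`|k| + nsq w + 1).
      by have := normr_ge0 k; have := nsq_ge0 w; lra.
    rewrite ltr_pdivlMr // -/d in h3.
    have e8 : 0 < e / 8 by lra.
    have gd : - (e / 8) <= g d /\ g d <= e / 8.
      apply/andP; rewrite -ler_norml -(@ler_pXn2r _ 2%N) ?nnegrE ?(ltW e8) //.
      rewrite real_normK ?num_real //; apply: le_trans (fk d) _.
      have := nsq_ge0 d; have := nsq_ge0 w; have := ler_norm k; nra.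
    have rd : - (e / 8) <= rdot d w /\ rdot d w <= e / 8.
      apply/andP; rewrite -ler_norml -(@ler_pXn2r _ 2%N) ?nnegrE ?(ltW e8) //.
      rewrite real_normK ?num_real //; apply: le_trans (rdot_sqr_le d w) _.
      have := nsq_ge0 d; have := nsq_ge0 w; have := normr_ge0 k; nra.
    move: h4 h1; rewrite dE /q nsqD gD; have := nsq_ge0 d; set r := _^-1; lra.
  exact: le_trans qle (qS u).
have gw u : g u = rdot u w.
  apply/eqP; rewrite -subr_eq0; apply/eqP; set c := _ - _.
  have hq (t : R) : 0 <= t ^+ 2 * nsq u - 2 * t * c.
    have := wmin (t%:C *: u + w); rewrite /q /c nsqD gD gZ nsqZ rdotZl; lra.
  have [->|c0] := eqVneq c 0; first by [].
  have c2 : 0 < c ^+ 2 by rewrite lt_def sqrf_eq0 c0 sqr_ge0.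
  have n0 := nsq_ge0 u.
  (* The quadratic in [t] is smallest at [c / nsq u]; adding 1 covers [u = 0] and still gives a
     negative value. *)
  have := hq (c / (nsq u + 1)).
  have -> : (c / (nsq u + 1)) ^+ 2 * nsq u - 2 * (c / (nsq u + 1)) * c =
            - (c ^+ 2 * (nsq u + 2) / (nsq u + 1) ^+ 2).
    by field; apply: lt0r_neq0; lra.
  rewrite oppr_ge0 leNgt; case/negP; apply: divr_gt0; last by apply: exprn_gt0; lra.
  by apply: mulr_gt0; lra.
exists w => u; apply: complex_ext; first exact: gw.
have := gw ((- 'i) *: u).
by rewrite /g -[(- 'i) *: u]addr0 fl f0 !addr0 /rdot linearZl_LR.
Qed.

Lemma bounded_op_nsq (x : H -> H) : bounded_op x ->
  exists2 k : R, 0 <= k & forall u, nsq (x u) <= k * nsq u.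
Proof.
case=> _ [k hk]; exists (complex.Re k ^+ 2) => [|u]; first exact: sqr_ge0.
have := hk u; have [->|u0] := eqVneq u 0.
  rewrite normr0 mulr0 normr_le0 => /eqP ->; rewrite nsq0; by rewrite mulr0.
have un : 0 < `|u| by rewrite normr_gt0.
move=> hu; have k0 : 0 <= k.
  by rewrite -(pmulr_lge0 _ un); apply: le_trans hu.
have kR : k = (complex.Re k)%:C by rewrite RRe_real // ger0_real.
rewrite -lecR rmorphM rmorphXn /= -kR -!dot_nsq -!hH -exprMn.
by rewrite ler_pXn2r ?nnegrE // mulr_ge0.
Qed.

Lemma nsq_bounded_op (x : H -> H) (k : R) : linear x ->
  (forall u, nsq (x u) <= k * nsq u) -> bounded_op x.
Proof.
move=> xl hk; split=> //; exists (Num.sqrt `|k|)%:C => u.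
rewrite -(@ler_pXn2r _ 2%N) ?nnegrE ?mulr_ge0 ?ler0c ?sqrtr_ge0 //.
rewrite exprMn !hH !dot_nsq -rmorphXn -rmorphM lecR sqr_sqrtr ?normr_ge0 //.
by apply: le_trans (hk u) _; apply: ler_wpM2r; [exact: nsq_ge0 | exact: ler_norm].
Qed.

Lemma adj_is_adjoint (x : H -> H) : bounded_op x -> is_adjoint dot x (adj dot x).
Proof.
move=> xb; have [k k0 hk] := bounded_op_nsq xb; have [xl _] := xb.
rewrite /adj; apply: (xgetPex (fun=> 0)).
have ex w : exists y, forall u, dot (x u) w = dot u y.
  apply: (@riesz (fun u => dot (x u) w) (k * nsq w)).
    by move=> a u v; rewrite xl linearPl.
  move=> u; apply: le_trans (rdot_sqr_le (x u) w) _.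
  by rewrite mulrAC; apply: ler_wpM2r; [exact: nsq_ge0|].
have [y hy] := choice ex; by exists y => u w; rewrite hy.
Qed.

End RealDot.

(** * Strong limits in weakly closed algebras *)

Section WeakClosure.
Context {R : realType} {H : completeNormedModType R[i]}.
Variable dot : {dot H for (@Num.conj R[i])}.
Hypothesis hH : hilbert_space dot.

(** The factor 2 comes from bounding the real and the imaginary part separately by Cauchy-Schwarz
    for [rdot]. *)
Lemma norm_dot_lt (u w : H) (e : R) : 0 < e ->
  2 * (nsq dot u * nsq dot w) < e ^+ 2 -> `|dot u w| < e%:C.
Proof.
move=> e0 h; rewrite -(@ltr_pXn2r _ 2%N) ?nnegrE ?normr_ge0 ?ler0c ?(ltW e0) //.
rewrite -add_Re2_Im2 -rmorphXn ltcR; apply: le_lt_trans h.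
have h1 := rdot_sqr_le dot u w; have h2 := rdot_sqr_le dot (- 'i *: u) w.
by rewrite nsqNi in h2; rewrite Im_dot; move: h1 h2; rewrite /rdot; lra.
Qed.

(** Linearity passes to the limit by uniqueness, boundedness by lower semicontinuity of the norm. A
    weak neighbourhood involves finitely many pairs of vectors, so one index serves them all. *)
Lemma wot_closed_slim M (s : nat -> H -> H) (y : H -> H) :
  weakly_closed_star_algebra dot M -> (forall n, M (s n)) ->
  (forall n u, nsq dot (s n u) <= nsq dot u) ->
  (forall u, slim dot (fun n => s n u) (y u)) -> M y.
Proof.
move=> hM Ms sle lim.
have sl n : linear (s n) by have [] := wcsa_bounded hM (Ms n).
have yl : linear y.
  move=> a u v; apply: (slim_uniq (lim _)).
  apply: slim_ext (slimD (slimZ a (lim u)) (lim v)) => n.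
  by rewrite sl.
apply: (wcsa_closed hM); split.
  apply: (nsq_bounded_op hH (k := 1)) => // u; rewrite mul1r.
  exact: (slim_nsq_le (lim u)).
move=> l e e0.
suff [N hN] : exists N, forall n, (N <= n)%N -> forall uw, uw \in l ->
    `|dot (y uw.1) uw.2 - dot (s n uw.1) uw.2| < e%:C.
  by exists (s N) => // uw /(hN _ (leqnn N)).
elim: l => [|[u w] l [N hN]]; first by exists 0%N.
have d0 : 0 < e ^+ 2 / (2 * nsq dot w + 1).
  by apply: divr_gt0; rewrite ?exprn_gt0 //; have := nsq_ge0 dot w; lra.
have [N' hN'] := lim u _ d0.
exists (maxn N N') => n; rewrite geq_max => /andP[Nn N'n] uw.
rewrite inE => /orP[/eqP -> /=|]; last exact: hN.
rewrite -linearBl; apply: norm_dot_lt => //.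
have := hN' n N'n; rewrite -nsqN opprB ltr_pdivlMr; last first.
  by have := nsq_ge0 dot w; lra.
have := nsq_ge0 dot (y u - s n u); have := nsq_ge0 dot w; nra.
Qed.

End WeakClosure.

(** * Represented *-algebras and positivity *)

Section StarRep.
Context {R : realType} {H : completeNormedModType R[i]}.
Variable dot : {dot H for (@Num.conj R[i])}.
Variables (A : algType R[i]) (act : A -> H -> H) (star : A -> A).
Local Notation rdt := (rdot dot).
Local Notation nrm := (nsq dot).
Local Notation slm := (slim dot).

(* Of weak closedness, only closure under strong limits of sequences of
   contractions is needed. *)
Record star_rep : Prop := {
  act_lin : forall x, linear (act x) ;
  actD : forall x y u, act (x + y) u = act x u + act y u ;
  actZ : forall (a : R[i]) x u, act (a *: x) u = a *: act x u ;
  actM : forall x y u, act (x * y) u = act x (act y u) ;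
  act1 : forall u, act 1 u = u ;
  act_inj : forall x y, (forall u, act x u = act y u) -> x = y ;
  act_star : forall x u w, dot (act x u) w = dot u (act (star x) w) ;
  act_bounded : forall x, exists2 k : R, 0 <= k &
    forall u, nrm (act x u) <= k * nrm u ;
  act_closed : forall (s : nat -> A) (y : H -> H),
    (forall n u, nrm (act (s n) u) <= nrm u) ->
    (forall u, slm (fun n => act (s n) u) (y u)) ->
    exists x, forall u, act x u = y u }.

Hypothesis hA : star_rep.
Implicit Types (x y z p q v a b : A) (u w : H) (r : R).

Let acD := actD hA. Let acZ := actZ hA. Let acM := actM hA. Let ac1 := act1 hA.
Let ac_inj := act_inj hA.

Lemma actvD x u u' : act x (u + u') = act x u + act x u'.
Proof. by have := act_lin hA x 1 u u'; rewrite !scale1r. Qed.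

Lemma actv0 x : act x 0 = 0.
Proof.
have := actvD x 0 0; rewrite addr0 => /eqP.
by rewrite -subr_eq0 opprD addNKr oppr_eq0 => /eqP.
Qed.

Lemma actvZ x (a : R[i]) u : act x (a *: u) = a *: act x u.
Proof. by have := act_lin hA x a u 0; rewrite !addr0 actv0 addr0. Qed.

Lemma actvB x u u' : act x (u - u') = act x u - act x u'.
Proof. by rewrite -scaleN1r actvD actvZ scaleN1r. Qed.

Lemma act0 u : act 0 u = 0.
Proof. by rewrite -(scale0r 0) acZ scale0r. Qed.

Lemma actN x u : act (- x) u = - act x u.
Proof. by rewrite -scaleN1r acZ scaleN1r. Qed.

Lemma actB x y u : act (x - y) u = act x u - act y u.
Proof. by rewrite acD actN. Qed.

Lemma rdot_star x u w : rdt (act x u) w = rdt u (act (star x) w).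
Proof. by rewrite /rdot (act_star hA). Qed.

Lemma act_ext x y : (forall u w, rdt (act x u) w = rdt (act y u) w) -> x = y.
Proof. by move=> h; apply: ac_inj => u; apply: rdot_ext => w; exact: h. Qed.

Lemma starK : involutive star.
Proof.
by move=> x; apply: act_ext => u w; rewrite [RHS]rdot_star rdotC -rdot_star rdotC.
Qed.

Lemma rdot_starV x u w : rdt (act (star x) u) w = rdt u (act x w).
Proof. by rewrite rdot_star starK. Qed.

Lemma starD x y : star (x + y) = star x + star y.
Proof.
by apply: act_ext => u w; rewrite acD rdotDl !rdot_starV acD rdotDr.
Qed.

Lemma starM x y : star (x * y) = star y * star x.
Proof. by apply: act_ext => u w; rewrite acM !rdot_starV acM. Qed.

Lemma starZ (a : R[i]) x : star (a *: x) = Num.conj a *: star x.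
Proof.
apply: ac_inj => u; apply: (dot_ext_r (dot := dot)) => w.
rewrite -rdot_star !acZ /rdot linearZl_LR linearZr_LR /= (act_star hA).
by rewrite [Num.conj (Num.conj _)]conjCK.
Qed.

Lemma starZr r x : star (r%:C *: x) = r%:C *: star x.
Proof. by rewrite starZ (_ : Num.conj _ = conjc r%:C) // conjc_real. Qed.

Lemma starN x : star (- x) = - star x.
Proof. by rewrite -scaleN1r -(rmorphN1 (real_complex R)) starZr rmorphN1 scaleN1r. Qed.

Lemma starB x y : star (x - y) = star x - star y.
Proof. by rewrite starD starN. Qed.

Lemma star1 : star 1 = 1.
Proof. by apply: act_ext => u w; rewrite rdot_starV !ac1. Qed.

Lemma star0 : star 0 = 0.
Proof. by have := starB 1 1; rewrite !subrr. Qed.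

Definition pos x := star x = x /\ forall u, 0 <= rdt (act x u) u.

Lemma posD x y : pos x -> pos y -> pos (x + y).
Proof.
move=> [hx px] [hy py]; split; first by rewrite starD hx hy.
by move=> u; rewrite acD rdotDl addr_ge0.
Qed.

Lemma pos1 : pos 1.
Proof. by split; [exact: star1 | move=> u; rewrite ac1; exact: nsq_ge0]. Qed.

Lemma posZ r x : 0 <= r -> pos x -> pos (r%:C *: x).
Proof.
move=> r0 [hx px]; split; first by rewrite starZr hx.
by move=> u; rewrite acZ rdotZl mulr_ge0.
Qed.

Lemma pos_conj x z : pos x -> pos (star z * x * z).
Proof.
move=> [hx px]; split; first by rewrite !starM starK hx mulrA.
by move=> u; rewrite !acM rdot_starV.
Qed.

Lemma pos_sq z : pos (star z * z).
Proof. by have := pos_conj z pos1; rewrite mulr1. Qed.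

Lemma pos_conj_self x z : star z = z -> pos x -> pos (z * x * z).
Proof. by move=> hz px; rewrite -{1}hz; exact: pos_conj. Qed.

(** Polarisation: the quadratic form of [x] vanishes, and self-adjointness recovers the bilinear
    form from it. *)
Lemma pos_antisym x : pos x -> pos (- x) -> x = 0.
Proof.
move=> [hx px] [_ nx]; have q0 u : rdt (act x u) u = 0.
  by apply/eqP; rewrite eq_le px andbT -oppr_ge0 -rdotNl -actN nx.
apply: act_ext => u w; rewrite act0 rdot0l.
have := q0 (u + w); rewrite actvD !rdotDl !rdotDr !q0 add0r addr0.
by rewrite (rdot_star x w) hx (rdotC _ w); lra.
Qed.

(* Riesz and Nagy: with [a_0 = a] and [a_{n+1} = a_n - a_n^2], the product
   [a b] is the strong limit of [\sum_(i < n) a_i b a_i]. *)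
Lemma pos_mul a b : pos a -> pos (1 - a) -> pos b -> a * b = b * a ->
  pos (a * b).
Proof.
move=> pa pa1 pb ab; split; first by rewrite starM; case: pa pb => -> _ [-> _].
move=> u; pose s := fun n => iter n (fun a => a - a * a) a.
have hs n : [/\ pos (s n), pos (1 - s n) & s n * b = b * s n].
  elim: n => [|n [p p1 c]] //=; set t := s n in p p1 c *.
  have ht : star t = t by case: p.
  have ht1 : star (1 - t) = 1 - t by case: p1.
  split.
  (* Both summands are conjugates of positive elements, so the next iterate is again positive. *)
  - have -> : t - t * t = t * (1 - t) * t + (1 - t) * t * (1 - t).
      by rewrite mulrBr mulr1 [(1 - t) * t]mulrBl mul1r -mulrDr [t + (1 - t)]addrC subrK mulr1.
    by apply: posD; apply: pos_conj_self.
  - have -> : 1 - (t - t * t) = (1 - t) + star t * t by rewrite ht opprB addrA addrAC.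
    by apply: posD => //; exact: pos_sq.
  - by rewrite mulrBl mulrBr -mulrA c mulrA c mulrA.
have sumE n : rdt (act (a * b) u) u =
    \sum_(i < n) rdt (act b (act (s i) u)) (act (s i) u) +
    rdt (act b u) (act (s n) u).
  elim: n => [|n ->].
    by rewrite big_ord0 add0r acM rdot_star; case: pa => ->.
  rewrite big_ord_recr /= -addrA; congr (_ + _).
  have [[st _] _ c] := hs n.
  move: (rdot_star (s n)); rewrite st => ss.
  have E : rdt (act b u) (act (s n) (act (s n) u)) =
           rdt (act b (act (s n) u)) (act (s n) u) by rewrite -ss -acM c acM.
  by rewrite actB rdotBr acM E addrCA subrr addr0.
(* The telescoping identity with [b = 1]: the sums of the [nrm (act (s i) u)] are bounded, so one of
   the terms is as small as desired. *)
have sum2E n : rdt (act a u) u =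
    \sum_(i < n) nrm (act (s i) u) + rdt (act (s n) u) u.
  elim: n => [|n ->]; first by rewrite big_ord0 add0r.
  rewrite big_ord_recr /= -addrA; congr (_ + _).
  have [[st _] _ _] := hs n.
  move: (rdot_star (s n)); rewrite st => ss.
  by rewrite actB rdotBl acM (ss (act (s n) u)) addrCA subrr addr0.
have small e : 0 < e -> exists n, nrm (act (s n) u) < e.
  move=> e0; apply: contrapT => /forallNP hn.
  have {}hn n : e <= nrm (act (s n) u) by rewrite leNgt; apply/negP.
  have q0 : 0 <= rdt (act a u) u / e by rewrite divr_ge0 ?(ltW e0) //; case: pa.
  have := archi_boundP q0; set n := Num.bound _; rewrite ltr_pdivrMr // ltNge.
  move/negP; apply; rewrite (sum2E n).
  have : \sum_(i < n) e <= \sum_(i < n) nrm (act (s i) u) by apply: ler_sum.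
  rewrite sumr_const card_ord => le1; rewrite mulr_natl; apply: le_trans le1 _.
  by rewrite lerDl; have [[_ ->]] := hs n.
apply/ler_addgt0Pr => e e0; rewrite -lerBlDr sub0r.
have B0 := nsq_ge0 dot (act b u).
have [n hn] : exists n, nrm (act (s n) u) < e ^+ 2 / (nrm (act b u) + 1).
  by apply: small; apply: divr_gt0; [rewrite exprn_gt0 | lra].
rewrite (sumE n).
have : 0 <= \sum_(i < n) rdt (act b (act (s i) u)) (act (s i) u).
  by apply: sumr_ge0 => i _; case: pb.
suff : - e <= rdt (act b u) (act (s n) u) by lra.
rewrite ltr_pdivlMr in hn; last lra.
rewrite leNgt; apply/negP => h2.
have := rdot_sqr_le dot (act b u) (act (s n) u).
have := nsq_ge0 dot (act (s n) u); nra.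
Qed.

End StarRep.

(** * Polar decomposition *)

Section Polar.
Context {R : realType} {H : completeNormedModType R[i]}.
Variable dot : {dot H for (@Num.conj R[i])}.
Variables (A : algType R[i]) (act : A -> H -> H) (star : A -> A).
Hypotheses (hH : hilbert_space dot) (hA : star_rep dot act star).
Implicit Types (x y z p q v a b g : A) (u w : H).
Local Notation rdt := (rdot dot).
Local Notation nrm := (nsq dot).
Local Notation slm := (slim dot).
Local Notation posn := (pos dot act star).

Definition contraction x := posn (1 - star x * x).

Lemma contractionP x : contraction x <-> forall u, nrm (act x u) <= nrm u.
Proof.
have E u : rdt (act (1 - star x * x) u) u = nrm u - nrm (act x u).
  by rewrite (actB hA) rdotBl (act1 hA) (actM hA) (rdot_starV hA).
split=> [[_ h] u|h]; first by have := h u; rewrite E subr_ge0.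
split=> [|u]; last by rewrite E subr_ge0.
by rewrite (starB hA) (star1 hA) (starM hA) (starK hA).
Qed.

(** Expanding [nsq (x (star x u) - u) >= 0] gives [2 * nsq (star x u) <= nsq (x (star x u)) + nsq
    u], and the first term on the right is at most [nsq (star x u)]. *)
Lemma contraction_star x : contraction x -> contraction (star x).
Proof.
move=> /contractionP h; apply/contractionP => u.
have := h (act (star x) u); have := nsq_ge0 dot (act x (act (star x) u) - u).
rewrite nsqB (rdot_star hA) -/(nsq _ _); lra.
Qed.

(* Newton's iteration [x (3 - x^* x) / 2], which drives every nonzero singular
   value of a contraction up to 1 and hence converges to its polar part. *)
Definition defect x := (2^-1 : R)%:C *: (1 - star x * x).
Definition newton x := x * (1 + defect x).
Local Notation itn := (fun n x => iter n newton x).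

Lemma sq_defect x : star x * x = 1 - (defect x + defect x).
Proof.
rewrite /defect -scalerDl -rmorphD /= (_ : 2^-1 + 2^-1 = 1 :> R); last by field.
by rewrite scale1r opprB addrC subrK.
Qed.

(** A fixed point of [newton] thus satisfies [x * star x * x = x]; applied along the iteration, this
    identity makes the limit a partial isometry. *)
Lemma newton_cubic x : x * star x * x = 3%:C *: x - 2%:C *: newton x.
Proof.
rewrite -mulrA sq_defect /newton mulrBr mulr1 !(mulrDr x) mulr1 !rmorph_nat !scaler_nat.
by rewrite [in RHS]mulrnDl [in RHS]opprD [RHS]addrA [x *+ 3]mulrS addrK mulr2n.
Qed.

Lemma star_defect x : star (defect x) = defect x.
Proof. by rewrite (starZr hA) (starB hA) (star1 hA) (starM hA) (starK hA). Qed.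

(** Both sides are polynomials in [defect x], so the identity is checked in a commutative polynomial
    ring and then evaluated. For a contraction the right side is positive, hence [newton] preserves
    contractions. *)
Lemma newton_sq x : 1 - star (newton x) * newton x =
  defect x * (3%:R + (defect x + defect x)) * defect x.
Proof.
rewrite (starM hA) (starD hA) (star1 hA) star_defect mulrA -(mulrA _ _ x).
rewrite sq_defect; set h := defect x.
have E : 1 - (1 + 'X) * (1 - ('X + 'X)) * (1 + 'X) =
  'X * (3%:R + ('X + 'X)) * 'X :> {poly R[i]} by ring.
have := congr1 (horner_alg h) E.
by rewrite !(rmorphB, rmorphM, rmorphD, rmorph1, rmorph_nat) /= !horner_algX.
Qed.

Lemma pos_nat n : posn n%:R.
Proof.
elim: n => [|n ih]; last by rewrite -natr1; apply: (posD hA) => //; exact: pos1.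
by split; [exact: (star0 hA) | move=> u; rewrite (act0 hA) rdot0l].
Qed.

Lemma defect_pos x : contraction x -> posn (defect x).
Proof. by move=> h; apply: (posZ hA) => //; rewrite invr_ge0. Qed.

Lemma newton_contraction x : contraction x -> contraction (newton x).
Proof.
move=> h; rewrite /contraction newton_sq.
apply: (pos_conj_self hA); first exact: star_defect.
by apply: (posD hA); [exact: pos_nat | apply: (posD hA); exact: defect_pos].
Qed.

Lemma newton_star x : star (newton x) = newton (star x).
Proof.
rewrite (starM hA) (starD hA) (star1 hA) star_defect /newton /defect (starK hA).
by rewrite mulrDl mulrDr mul1r mulr1 -scalerAl -scalerAr mulrBl mulrBr mul1r mulr1 mulrA.
Qed.

Lemma iter_newton_contraction n x : contraction x -> contraction (itn n x).
Proof. by move=> h; elim: n => //= n; exact: newton_contraction. Qed.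

Lemma iter_newton_star n x : star (itn n x) = itn n (star x).
Proof. by elim: n => //= n ih; rewrite newton_star ih. Qed.

(** Stands in for real functions of [a]: such elements commute with one another and with whatever
    [a] commutes with. *)
Definition in_commutant2 a y :=
  star y = y /\ forall z, a * z = z * a -> y * z = z * y.

(** Each iterate is [x] times a function of [star x * x] that is at least 1. Products of positive
    elements are positive only when the factors commute, and the double commutant supplies this. *)
Lemma iter_newton_factor n x : contraction x ->
  exists g, [/\ in_commutant2 (star x * x) g, itn n x = x * g & posn (g - 1)].
Proof.
set a := star x * x => cx.
have sa : star a = a by rewrite (starM hA) (starK hA).
elim: n => [|n [g [[sg cg] xg pg]]].
  exists 1; split; first by split=> [|z _]; rewrite ?(star1 hA) // mul1r mulr1.
    by rewrite mulr1.
  by rewrite subrr; exact: pos_nat 0%N.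
set y := itn n x in xg *.
have cy : contraction y by exact: iter_newton_contraction.
have ay : star y * y = g * a * g by rewrite xg (starM hA) sg mulrA -(mulrA g).
set h := defect y; have ph : posn h := defect_pos cy.
have ch z : a * z = z * a -> h * z = z * h.
  move=> az; have gz := cg _ az.
  rewrite /h /defect ay -scalerAl -scalerAr mulrBl mulrBr mul1r mulr1.
  by rewrite -(mulrA _ g z) gz -(mulrA g a) (mulrA a) az -(mulrA z) mulrA gz !mulrA.
exists (g * (1 + h)); split.
- have ch1 z : a * z = z * a -> (1 + h) * z = z * (1 + h).
    by move=> az; rewrite mulrDl mulrDr mul1r mulr1 ch.
  split=> [|z az]; last by rewrite -mulrA ch1 // mulrA cg // -mulrA.
  by rewrite (starM hA) (starD hA) (star1 hA) star_defect sg ch1 // cg.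
- by rewrite /= -/y /newton -/h mulrA -xg.
(* The new factor minus 1 is [(g - 1) + g * h], where [g] and [h] are positive and commute. *)
- rewrite mulrDr mulr1 addrAC; apply: (posD hA) => //.
  have gh : h * g = g * h by apply: ch; rewrite cg.
  rewrite -gh /h /defect -scalerAl; apply: (posZ hA); first by rewrite invr_ge0.
  apply: (pos_mul hA) => //.
  - by rewrite opprB addrC subrK; exact: pos_sq.
  - by rewrite -[g](subrK 1); apply: (posD hA) => //; exact: pos1.
  - rewrite mulrBl mulrBr mul1r mulr1 ay.
    have ga : g * a = a * g by exact: cg.
    by rewrite ga (mulrA g (a * g)) (mulrA g a) ga.
Qed.

Lemma iter_newton_pos n x : contraction x -> posn (star x * itn n x - star x * x).
Proof.
move=> cx; have [g [[sg cg] -> pg]] := iter_newton_factor n cx.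
rewrite mulrA -{2}[_ * x]mulr1 -mulrBr; apply: (pos_mul hA) => //.
  exact: pos_sq.
by rewrite mulrBl mulrBr mul1r mulr1 cg.
Qed.

(** By [iter_newton_pos] the inner product of a later iterate with an earlier one, both applied to
    [u], is at least the squared norm of the earlier one. The squared norm can therefore serve as
    [F] in [slim_mono]. *)
Lemma iter_newton_mono x n m u : contraction x -> (n <= m)%N ->
  nrm (act (itn m x) u - act (itn n x) u) <=
  nrm (act (itn m x) u) - nrm (act (itn n x) u).
Proof.
move=> cx nm; rewrite -(subnK nm) iterD; set y := iter n newton x.
have cy : contraction y by exact: iter_newton_contraction.
have [_ /(_ u)] := iter_newton_pos (m - n) cy.
rewrite (actB hA) rdotBl !(actM hA) !(rdot_starV hA) nsqB -/(nsq _ _); lra.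
Qed.

Lemma newton_lim x : contraction x ->
  exists v, forall u, slm (fun n => act (itn n x) u) (act v u).
Proof.
move=> cx.
have ex u : exists l, slm (fun n => act (itn n x) u) l.
  apply: (slim_mono hH (F := fun n => nrm (act (itn n x) u)) (B := nrm u)).
    by move=> n m; exact: iter_newton_mono.
  by move=> n; move: u; apply/contractionP; exact: iter_newton_contraction.
have [y hy] := choice ex.
have [v hv] : exists v, forall u, act v u = y u.
  apply: (act_closed hA (s := fun n => itn n x)) => // n.
  by apply/contractionP; exact: iter_newton_contraction.
by exists v => u; rewrite hv.
Qed.

Lemma pos_lim (s : nat -> A) v : (forall n, posn (s n)) ->
  (forall u, slm (fun n => act (s n) u) (act v u)) -> posn v.
Proof.
move=> ps h; split=> [|u]; last first.
  by apply: (slim_rdot_ge (h u)) => n; case: (ps n).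
apply: (act_ext hA) => u w; rewrite (rdot_starV hA) rdotC.
apply: (slim_rdot_eq2 (h w) (h u)) => n; rewrite rdotC -(rdot_starV hA).
by case: (ps n) => ->.
Qed.

(** The limit [v] of the iteration is the polar part of [x]: [star v * v] is the right support of
    [x], [star x * v] its absolute value, and for self-adjoint [x] the element [v] is its sign. *)
Lemma contraction_polar x : contraction x -> exists v,
  [/\ v * star v * v = v, x * (star v * v) = x,
      forall y, x * y = 0 -> v * y = 0, forall q, q * x = x -> q * v = v &
      posn (star x * v) /\ (star x = x -> star v = v)].
Proof.
move=> cx; have [v hv] := newton_lim cx.
(* Taking adjoints is not strongly continuous, so [star v] is obtained as the limit of the iteration
   started at [star x]. *)
have [v' hv'] := newton_lim (contraction_star cx).
have hcx n : contraction (itn n x) by exact: iter_newton_contraction.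
have hcx' n : contraction (itn n (star x)).
  by apply: iter_newton_contraction; exact: contraction_star.
have lip n u : nrm (act (itn n x) u) <= 1 * nrm u.
  by rewrite mul1r; move: u; apply/contractionP.
have lip' n u : nrm (act (itn n (star x)) u) <= 1 * nrm u.
  by rewrite mul1r; move: u; apply/contractionP.
have sv : star v = v'.
  apply: (act_ext hA) => u w.
  rewrite (rdot_starV hA) rdotC; apply: (slim_rdot_eq2 (hv w) (hv' u)) => n.
  by rewrite -iter_newton_star (rdot_starV hA) rdotC.
have vvv : v * star v * v = v.
  apply: (act_inj hA) => u.
  have h1 : slm (fun n => act (itn n (star x)) (act (itn n x) u)) (act v' (act v u)).
    by apply: (slim_op (fun n => actvB hA _) lip' (hv u)).
  have h2 : slm (fun n => act (itn n x) (act (itn n (star x)) (act (itn n x) u)))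
                (act v (act v' (act v u))).
    by apply: (slim_op (fun n => actvB hA _) lip h1).
  have h3 := slimZ (2%:C) (slim_shift 1 (hv u)).
  have h4 := slimZ (3%:C) (hv u).
  rewrite sv !(actM hA); apply: (slim_uniq h2).
  have -> : act v u = 3%:C *: act v u - 2%:C *: act v u.
    by rewrite -scalerBl -rmorphB (_ : 3 - 2 = 1 :> R) ?scale1r //; ring.
  apply: slim_ext (slimB h4 h3) => n; rewrite addn1 /=.
  by rewrite -!(actM hA) -iter_newton_star newton_cubic (actB hA) !(actZ hA).
(* The norms increase along the iteration, so the kernel of [v] lies in that of [x]; it contains the
   range of [1 - star v * v]. *)
have mono n u : nrm (act x u) <= nrm (act (itn n x) u).
  have := iter_newton_mono u cx (leq0n n).
  have := nsq_ge0 dot (act (itn n x) u - act x u); rewrite /=; lra.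
have xe : x * (star v * v) = x.
  apply/eqP; rewrite -{2}[x]mulr1 -subr_eq0 -mulrBr; apply/eqP.
  apply: (act_inj hA) => u; rewrite (act0 hA); apply: (nsq_eq0 (dot := dot)).
  apply/eqP; rewrite eq_le nsq_ge0 andbT (actM hA).
  set w := act _ u; have vw : act v w = 0.
    by rewrite /w -(actM hA) mulrBr mulr1 mulrA vvv subrr (act0 hA).
  apply/ler_addgt0Pr => e e0; have [N /(_ N (leqnn N))] := hv w e e0.
  by rewrite vw subr0 add0r => /ltW; apply: le_trans.
have ker y : x * y = 0 -> v * y = 0.
  move=> xy; have Z n : itn n x * y = 0.
    elim: n => // n ih /=; rewrite /newton /defect -mulrA mulrDl mul1r mulrDr ih add0r.
    by rewrite -scalerAl mulrBl -mulrA ih mulr0 subr0 mul1r -scalerAr ih scaler0.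
  apply: (act_inj hA) => u; rewrite (actM hA) (act0 hA).
  apply: (slim_uniq (hv _)); apply: slim_ext (slim_cst dot 0) => n.
  by rewrite -(actM hA) Z (act0 hA).
exists v; split=> //.
- move=> q qx; have Z n : q * itn n x = itn n x.
    by elim: n => // n ih /=; rewrite /newton mulrA ih.
  have [k k0 hk] := act_bounded hA q.
  apply: (act_inj hA) => u; rewrite (actM hA).
  apply: (slim_uniq (slim_op1 (actvB hA _) hk (hv u))).
  by apply: slim_ext (hv u) => n; rewrite -(actM hA) Z.
- split.
  apply: (pos_lim (s := fun n => star x * itn n x)) => [n|u].
    rewrite -[_ * _](subrK (star x * x)); apply: (posD hA).
      exact: iter_newton_pos.
    exact: pos_sq.
  have [k k0 hk] := act_bounded hA (star x).
  rewrite (actM hA); apply: slim_ext (slim_op1 (actvB hA _) hk (hv u)) => n.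
  by rewrite (actM hA).
- move=> sx; apply: (act_inj hA) => u; rewrite sv; apply: (slim_uniq (hv' u)).
  by rewrite sx.
Qed.
End Polar.

(** * Polar parts, chains of partial isometries and minimal projections *)

Section Projections.
Context {R : realType} {H : completeNormedModType R[i]}.
Variable dot : {dot H for (@Num.conj R[i])}.
Variables (A : algType R[i]) (act : A -> H -> H) (star : A -> A).
Hypotheses (hH : hilbert_space dot) (hA : star_rep dot act star).
Implicit Types (x y z p q v w t a b g : A) (u : H).
Local Notation rdt := (rdot dot).
Local Notation nrm := (nsq dot).
Local Notation slm := (slim dot).
Local Notation posn := (pos dot act star).

Lemma scaler_realK (r : R) x : r != 0 -> r^-1%:C *: (r%:C *: x) = x.
Proof. by move=> r0; rewrite scalerA -rmorphM /= mulVf // scale1r. Qed.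

Lemma scale_half x : (2^-1 : R)%:C *: (x *+ 2) = x.
Proof.
rewrite mulr2n scalerDr -scalerDl -rmorphD /= (_ : 2^-1 + 2^-1 = 1 :> R).
  by rewrite scale1r.
by field.
Qed.

Lemma contraction_scale x :
  exists2 r : R, 0 < r & contraction dot act star (r%:C *: x).
Proof.
have [k k0 hk] := act_bounded hA x.
have k1 : 0 < k + 1 by lra.
(* [k] bounds squared norms, and [k <= (k + 1)^2]. *)
exists (k + 1)^-1; first by rewrite invr_gt0.
apply/(contractionP hA) => u; rewrite (actZ hA) nsqZ exprVn.
rewrite mulrC ler_pdivrMr ?exprn_gt0 //; apply: le_trans (hk u) _.
by rewrite mulrC ler_wpM2l ?nsq_ge0 //; nra.
Qed.

Lemma polar x : exists v,
  [/\ v * star v * v = v, x * (star v * v) = x,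
      forall y, x * y = 0 -> v * y = 0, forall q, q * x = x -> q * v = v &
      posn (star x * v) /\ (star x = x -> star v = v)].
Proof.
have [r r0 cx] := contraction_scale x.
have rn0 : r != 0 by rewrite gt_eqF.
have [v [h1 h2 h3 h4 [h5 h6]]] := contraction_polar hH hA cx.
exists v; split=> //.
- by rewrite -[LHS](scaler_realK _ rn0) scalerAl h2 scaler_realK.
- by move=> y xy; apply: h3; rewrite -scalerAl xy scaler0.
- by move=> q qx; apply: h4; rewrite -scalerAr qx.
- split; last by move=> sx; apply: h6; rewrite (starZr hA) sx.
  rewrite -[star x * v](scaler_realK _ rn0) scalerAl -(starZr hA).
  by apply: (posZ hA) => //; rewrite invr_ge0 ltW.
Qed.

(* For partial isometries: [w] extends [v], i.e. [w - v] is a partial isometry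
   whose initial and final projections are orthogonal to those of [v]. *)
Definition psub v w := w * (star v * v) = v /\ star w * v = star v * v.

Lemma psub_refl v : v * star v * v = v -> psub v v.
Proof. by rewrite /psub mulrA. Qed.

Lemma psub_trans v w t : psub v w -> psub w t -> psub v t.
Proof.
move=> [h1 h2] [h3 h4].
have h5 : star w * w * (star v * v) = star v * v by rewrite -mulrA h1.
split; first by rewrite -h5 mulrA h3 h1.
by rewrite -[v in LHS]h1 mulrA h4 h5.
Qed.

Lemma pisom_contraction v : v * star v * v = v -> forall u, nrm (act v u) <= nrm u.
Proof.
move=> h; apply/(contractionP hA); rewrite /contraction.
have ee : star v * v * (star v * v) = star v * v by rewrite -mulrA (mulrA v) h.
have se : star (1 - star v * v) = 1 - star v * v.
  by rewrite (starB hA) (star1 hA) (starM hA) (starK hA).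
have -> : 1 - star v * v = star (1 - star v * v) * (1 - star v * v).
  by rewrite se mulrBl mul1r mulrBr mulr1 ee subrr subr0.
exact: pos_sq.
Qed.

(** For [n <= m] the ranges of [s n] and [s m - s n] are orthogonal, so
    [nrm (act (s m) u - act (s n) u)] is exactly the increment of [nrm (act (s n) u)]. The last
    clause carries to the limit any property written as [y * s n * z = 0]. *)
Lemma psub_chain (s : nat -> A) : (forall n, s n * star (s n) * s n = s n) ->
  (forall n, psub (s n) (s n.+1)) ->
  exists v, [/\ v * star v * v = v, forall n, psub (s n) v &
    forall y z, (forall n, y * s n * z = 0) -> y * v * z = 0].
Proof.
move=> sp sS.
have sle n m : (n <= m)%N -> psub (s n) (s m).
  move=> /subnK <-; elim: (m - n)%N => [|k ih]; first exact: psub_refl.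
  by rewrite addSn; exact: psub_trans ih (sS _).
have sc n u : nrm (act (s n) u) <= nrm u by exact: pisom_contraction.
have sc1 n u : nrm (act (s n) u) <= 1 * nrm u by rewrite mul1r.
have ex u : exists l, slm (fun n => act (s n) u) l.
  apply: (slim_mono hH (F := fun n => nrm (act (s n) u)) (B := nrm u)) => // n m nm.
  have [_ h] := sle _ _ nm; rewrite nsqB.
  rewrite [rdt _ (act (s n) u)]rdotC -(rdot_starV hA) -(actM hA) h.
  rewrite (actM hA) (rdot_starV hA) -/(nsq _ _); lra.
have [y hy] := choice ex; have [v hv] := act_closed hA sc hy.
have {hy} lim u : slm (fun n => act (s n) u) (act v u) by rewrite hv.
have lim0 y' z : (forall n, y' * s n * z = 0) -> y' * v * z = 0.
  move=> h; have [k k0 hk] := act_bounded hA y'.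
  apply: (act_inj hA) => u; rewrite (act0 hA) !(actM hA).
  apply: (slim_uniq (slim_op1 (actvB hA _) hk (lim _))).
  by apply: slim_ext (slim_cst dot 0) => n; rewrite -!(actM hA) h (act0 hA).
have sub n : psub (s n) v.
  split.
    apply: (act_inj hA) => u; rewrite (actM hA); apply: (slim_uniq (lim _)).
    move=> e e0; exists n => m nm; have [h _] := sle _ _ nm.
    by rewrite -(actM hA) h subrr nsq0.
  apply: (act_ext hA) => u u'; rewrite (actM hA) (rdot_starV hA) rdotC.
  apply: (slim_rdot_eq (slim_shift n (lim u'))) => m.
  by have [_ <-] := sle _ _ (leq_addl m n); rewrite rdotC (actM hA) (rdot_starV hA).
exists v; split=> //.
(* This is [v * star v * v = v] in a form to which [lim0] applies, since [psub] gives
   [v * star v * s n = s n]. *)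
have h : (v * star v - 1) * v * 1 = 0.
  apply: lim0 => n; have [h1 h2] := sub n.
  by rewrite mulr1 mulrBl mul1r -mulrA h2 h1 subrr.
by apply/eqP; rewrite -subr_eq0; apply/eqP; move: h; rewrite mulr1 mulrBl mul1r.
Qed.

Definition proj p := p * p = p /\ star p = p.

(* The polar part of a self-adjoint [b] in the corner of [p] is [1_(b > 0) -
   1_(b < 0)], so minimality of [p] forces [b >= 0] or [b <= 0]. *)
Lemma minimal_scalar p : proj p ->
  (forall q, proj q -> q * p = q -> q = 0 \/ q = p) ->
  forall x, exists c : R[i], p * x * p = c *: p.
Proof.
move=> [pp sp] min.
have sgn b : star b = b -> p * b * p = b -> posn b \/ posn (- b).
  move=> sb pbp.
  have [v [h1 h2 h3 h4 [h5 /(_ sb) sv]]] := polar b.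
  rewrite sv in h1 h2; rewrite sb in h5.
  have bp : b * p = b by rewrite -pbp -mulrA pp.
  have vp : v * p = v.
    apply/eqP; rewrite -subr_eq0 -{2}[v]mulr1 -mulrBr; apply/eqP/h3.
    by rewrite mulrBr mulr1 bp subrr.
  have ve : v * (v * v) = v by rewrite mulrA.
  have pe : proj (v * v) by split; [rewrite mulrA h1 | rewrite (starM hA) sv].
  have [e0|ep] := min _ pe (esym (esym (etrans (esym (mulrA v v p)) (congr1 _ vp)))).
    left; rewrite -h2 e0 mulr0; exact: pos_nat hA 0%N.
  pose hf : R[i] := (2^-1 : R)%:C.

  (* Now [v * v = p], and [(p + v) / 2] is the spectral projection of [b > 0]. By minimality it is
     0, and then [v = - p], or it is [p], and then [v = p]. *)
  have pf : proj (hf *: (p + v)).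
    have pv : p * v = v by rewrite -ep -mulrA.
    split; last by rewrite (starZr hA) (starD hA) sp sv.
    rewrite -scalerAl -scalerAr mulrDl !mulrDr pp pv vp ep.
    by rewrite [v + p]addrC -mulr2n scale_half.
  have fp : hf *: (p + v) * p = hf *: (p + v) by rewrite -scalerAl mulrDl pp vp.
  have hf0 : hf != 0
    by rewrite /hf -(rmorph0 (real_complex R)) (inj_eq (@complexI R)) invr_eq0.
  have [/eqP|/eqP] := min _ pf fp.
    rewrite scaler_eq0 (negPf hf0) /= addrC addr_eq0 => /eqP vN; right.
    by move: h5; rewrite vN mulrN bp.
  have pE : p = hf *: (p + p) by rewrite -mulr2n scale_half.
  rewrite [X in _ == X]pE -subr_eq0 -scalerBr scaler_eq0 (negPf hf0) /=.
  rewrite opprD addrACA subrr add0r subr_eq0.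
  by move=> /eqP vE; left; move: h5; rewrite vE bp.
have [->|p0] := eqVneq p 0; first by move=> x; exists 0; rewrite mulr0 scale0r.
have sa a : star a = a -> p * a * p = a -> exists r : R, a = r%:C *: p.
  move=> sa pap.
  have bd (r : R) : posn (a - r%:C *: p) \/ posn (- (a - r%:C *: p)).
    apply: sgn; first by rewrite (starB hA) (starZr hA) sa sp.
    by rewrite mulrBr mulrBl pap -scalerAr -scalerAl !pp.
  pose n u := nrm (act p u); pose q u := rdt (act a u) u.
  have E r u : rdt (act (a - r%:C *: p) u) u = q u - r * n u.
    rewrite (actB hA) rdotBl (actZ hA) rdotZl /n /nsq -(rdot_starV hA) sp.
    by rewrite -(actM hA) pp.
  have q0 u : n u = 0 -> q u = 0.
    move=> /nsq_eq0 pu; rewrite /q -pap (actM hA) pu.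
    by rewrite (actv0 hA) rdot0l.
  have [u nu] : exists u, n u != 0.
    apply: contrapT => /forallNP h; move/eqP: p0; apply; apply: (act_inj hA) => u.
    by rewrite (act0 hA); apply: (nsq_eq0 (dot := dot)); apply/eqP/negP => /negP /h.
  have ngt (w : H) : n w != 0 -> 0 < n w by rewrite lt_def => ->; exact: nsq_ge0.
  have qw (w : H) : q w = q u / n u * n w.
    have [nw|nw] := eqVneq (n w) 0; first by rewrite nw mulr0 q0.
    have hu := ngt _ nu; have hw := ngt _ nw.
    suff -> : q u / n u = q w / n w by rewrite divfK.
    set r := q u / n u; set r' := q w / n w.
    have qu : q u = r * n u by rewrite divfK.
    have qw' : q w = r' * n w by rewrite divfK.
    (* If [r] and [r'] differed, the form of [a] minus their mean times [p] would be positive at one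
       of [u], [w] and negative at the other. *)
    case: (bd ((r + r') / 2)) => -[_ h].
      have := h u; have := h w; rewrite !E qu qw' -!mulrBl !pmulr_lge0 //; lra.
    have := h u; have := h w; rewrite !(actN hA) !rdotNl !E qu qw' -!mulrBl.
    by rewrite !oppr_ge0 !pmulr_lle0 //; lra.
  exists (q u / n u); apply/eqP; rewrite -subr_eq0; apply/eqP.
  have sr : star (a - (q u / n u)%:C *: p) = a - (q u / n u)%:C *: p.
    by rewrite (starB hA) (starZr hA) sa sp.
  by apply: (pos_antisym hA); split=> [|w];
    rewrite ?(starN hA) ?sr // ?(actN hA) ?rdotNl E qw subrr ?oppr0.
move=> x; pose y := p * x * p.
have sy : star y = p * star x * p by rewrite !(starM hA) sp mulrA.
have pyp : p * y * p = y by rewrite /y !mulrA pp -mulrA pp.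
have psyp : p * star y * p = star y by rewrite sy !mulrA pp -mulrA pp.
have [r hr] : exists r : R, y + star y = r%:C *: p.
  by apply: sa; rewrite ?(starD hA) ?(starK hA) 1?addrC // mulrDr mulrDl pyp psyp.
have [r' hr'] : exists r : R, 'i *: (y - star y) = r%:C *: p.
  apply: sa; last by rewrite -scalerAr -scalerAl mulrBr mulrBl pyp psyp.
  rewrite (starZ hA) (starB hA) (starK hA) -(conj_Ni R) [Num.conj (Num.conj _)]conjCK.
  by rewrite scaleNr -scalerN opprB conj_Ni.
(* [y] is half of [(y + star y) - 'i * ('i * (y - star y))]. *)
exists ((2^-1 : R)%:C * (r%:C - 'i * r'%:C)).
rewrite -scalerA scalerBl -scalerA -hr -hr' scalerA -expr2 sqr_i scaleN1r opprK.
by rewrite addrACA subrr addr0 -mulr2n scale_half.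
Qed.

End Projections.

(** * Comparison of projections *)

Section Comparison.
Context {R : realType} {H : completeNormedModType R[i]}.
Variable dot : {dot H for (@Num.conj R[i])}.
Variables (A : algType R[i]) (act : A -> H -> H) (star : A -> A) (tr : A -> R).
Hypotheses (hH : hilbert_space dot) (hA : star_rep dot act star).
Implicit Types (x y z p q e v w : A).

Local Notation prj := (proj star).
Local Notation sub := (psub star).
Local Notation pisom v := (v * star v * v = v).

Record tracial_factor : Prop := {
  trD : forall x y, tr (x + y) = tr x + tr y ;
  trC : forall x y, tr (x * y) = tr (y * x) ;
  tr_ge0 : forall x, 0 <= tr (star x * x) ;
  tr_eq0 : forall x, tr (star x * x) = 0 -> x = 0 ;
  tr1 : tr 1 = 1 ;
  center_scalar : forall x, (forall y, x * y = y * x) ->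
    exists a : R[i], x = a *: 1 ;
  no_abelian : forall p, prj p ->
    (forall x y, p * x * p * (p * y * p) = p * y * p * (p * x * p)) -> p = 0 }.

Hypothesis hT : tracial_factor.

Let sK := starK hA. Let sM := starM hA. Let sB := starB hA. Let sD := starD hA.

Lemma tr0 : tr 0 = 0.
Proof. by have := trD hT 0 0; rewrite addr0; lra. Qed.

Lemma trB x y : tr (x - y) = tr x - tr y.
Proof. by have := trD hT (x - y) y; rewrite subrK; lra. Qed.

Lemma tr_sum (I : Type) (r : seq I) (F : I -> A) :
  tr (\sum_(i <- r) F i) = \sum_(i <- r) tr (F i).
Proof. exact: (big_morph tr (trD hT) tr0). Qed.

Lemma proj_tr_ge0 p : prj p -> 0 <= tr p.
Proof. by move=> [pp sp]; have := tr_ge0 hT p; rewrite sp pp. Qed.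

Lemma proj_tr_eq0 p : prj p -> tr p = 0 -> p = 0.
Proof. by move=> [pp sp] h; apply: (tr_eq0 hT); rewrite sp pp. Qed.

Lemma proj_tr_gt0 p : prj p -> p != 0 -> 0 < tr p.
Proof.
move=> pp p0; rewrite lt_def proj_tr_ge0 // andbT.
by apply: contra_neq p0; exact: proj_tr_eq0.
Qed.

Lemma projB p q : prj p -> prj q -> p * q = q -> prj (p - q).
Proof.
move=> [pp sp] [qq sq] pq; have qp : q * p = q by rewrite -[RHS]sq -[in RHS]pq sM sp sq.
split; last by rewrite sB sp sq.
by rewrite mulrBl !mulrBr pp pq qp qq subrr subr0.
Qed.

Lemma proj_one : prj 1.
Proof. by split; [rewrite mulr1 | exact: star1 hA]. Qed.

Lemma proj_tr_le1 p : prj p -> tr p <= 1.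
Proof.
move=> pp; have := proj_tr_ge0 (projB proj_one pp (mul1r p)).
by rewrite trB (tr1 hT) subr_ge0.
Qed.

Lemma pisom_proj v : pisom v -> prj (star v * v).
Proof. by move=> h; split; [rewrite -mulrA (mulrA v) h | rewrite sM sK]. Qed.

Lemma pisom_star v : pisom v -> star v * v * star v = star v.
Proof. by move=> h; rewrite -[in RHS]h !sM sK mulrA. Qed.

Lemma pisom_projV v : pisom v -> prj (v * star v).
Proof. by move=> h; split; [rewrite mulrA h | rewrite sM sK]. Qed.

Lemma proj_pisom p : prj p -> pisom p.
Proof. by move=> [pp ->]; rewrite pp. Qed.

(** The difference is [v * (1 - star v * v)], and [star v * v * (1 - star v * v) = 0] makes the
    trace of its square vanish. *)
Lemma pisom_of_proj v : prj (star v * v) -> pisom v.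
Proof.
move=> [ee _]; apply/eqP; rewrite eq_sym -subr_eq0; apply/eqP/(tr_eq0 hT).
have E : v - v * star v * v = v * (1 - star v * v) by rewrite mulrBr mulr1 mulrA.
rewrite E sM sB (star1 hA) sM sK mulrA -(mulrA _ (star v)).
by rewrite [(1 - _) * (_ * _)]mulrBl mul1r ee subrr mul0r tr0.
Qed.

Lemma psub_tr v w : sub v w ->
  tr (star (w - v) * (w - v)) = tr (star w * w) - tr (star v * v).
Proof.
move=> [h1 h2]; have h3 : star v * w = star v * v by rewrite -[LHS]sK sM sK h2 sM sK.
by rewrite sB mulrBl !mulrBr h2 h3 subrr subr0 trB.
Qed.

Lemma psub_tr_le v w : sub v w -> tr (star v * v) <= tr (star w * w).
Proof. by move=> h; rewrite -subr_ge0 -psub_tr //; exact: tr_ge0. Qed.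

(* The Brezis-Browder principle for the trace of the initial projection. *)
Lemma maximal_pisom (S : set A) : S !=set0 -> (forall v, S v -> pisom v) ->
  (forall s : nat -> A, (forall n, S (s n)) -> (forall n, sub (s n) (s n.+1)) ->
    exists2 w, S w & forall n, sub (s n) w) ->
  exists2 v, S v & forall w, S w -> sub v w -> w = v.
Proof.
move=> [v0 Sv0] Sp Sc; pose f v := tr (star v * v).
have f1 v : S v -> f v <= 1 by move=> /Sp /pisom_proj /proj_tr_le1.
(* [w] covers at least half of the distance from [f v] to the supremum of [f] over the extensions of
   [v]; the inequality says so without naming the supremum. *)
have nxt v : exists w, S v ->
    [/\ S w, sub v w & forall w', S w' -> sub v w' -> f w' + f v <= 2 * f w].
  have [Sv|nSv] := pselect (S v); last by exists v.
  pose T := [set f w | w in [set w | S w /\ sub v w]].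
  have vT : T (f v) by exists v => //; split=> //; exact/psub_refl/Sp.
  have hT' : has_sup T.
    by split; [exists (f v) | exists 1 => _ [w [Sw _] <-]; exact: f1].
  have ub w : S w -> sub v w -> f w <= sup T.
    by move=> Sw vw; apply: ub_le_sup; [case: hT' | exists w].
  have [le|lt] := leP (sup T) (f v).
    exists v => _; split=> //; first exact/psub_refl/Sp.
    by move=> w' Sw' vw'; have := ub _ Sw' vw'; lra.
  have e0 : 0 < (sup T - f v) / 2 by lra.
  have [_ [w [Sw vw] <-] hw] := sup_adherent e0 hT'.
  by exists w => _; split=> // w' Sw' vw'; have := ub _ Sw' vw'; lra.
have [g hg] := choice nxt; pose s n := iter n g v0.
have Ss n : S (s n) by elim: n => //= n /hg [].
have ss n : sub (s n) (s n.+1) by have [] := hg _ (Ss n).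
have [w Sw sw] := Sc _ Ss ss; exists w => // w' Sw' ww'.
have fw : f w <= f w' by exact: psub_tr_le.
suff E : f w' <= f w.
  apply/eqP; rewrite -subr_eq0; apply/eqP/(tr_eq0 hT).
  by rewrite (psub_tr ww'); rewrite -/(f w') -/(f w); lra.
(* If the trace grew by [d] from [w] to [w'], every step of the chain would have gained at least
   [d / 2], against the bound 1. *)
rewrite leNgt; apply/negP => lt; pose d := f w' - f w.
have d0 : 0 < d by rewrite /d; lra.
have grow n : f v0 + n%:R * (d / 2) <= f (s n).
  elim: n => [|n ih]; first by rewrite mul0r addr0.
  have [_ _ /(_ w' Sw' (psub_trans (sw n) ww'))] := hg _ (Ss n).
  have : f (s n) <= f w by exact: psub_tr_le.
  rewrite [s n.+1]/= -[n.+1%:R]natr1; move: ih; rewrite /d.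
  by move: (f (s n)) (f (g (s n))) (n%:R : R) => *; lra.
have q0 : 0 <= 2 / d by rewrite divr_ge0 // ltW.
have := archi_boundP q0; set n := Num.bound _; rewrite ltr_pdivrMr // => hn.
have := grow n; have := f1 _ (Ss n); have : 0 <= f v0 by exact: tr_ge0.
move: hn; move: (n%:R : R) => N; lra.
Qed.

(* If [q A p = 0], then the largest projection [z] with [z A p = 0] is central. *)
Lemma proj_connected p q : prj p -> prj q -> p != 0 -> q != 0 ->
  exists x, q * x * p != 0.
Proof.
move=> hp hq p0 q0; apply: contrapT => /forallNP h.
have {}h x : q * x * p = 0 by apply/eqP/negP => /negP/h.
pose J z := forall y, z * y * p = 0.
pose S := [set z | prj z /\ J z].
have [| | |z [[zz sz] Jz] zmax] := @maximal_pisom S.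
- by exists q.
- by move=> v [/proj_pisom].
- move=> s Ss ss; have sp n : pisom (s n) by have [/proj_pisom] := Ss n.
  have [v [pv sv limv]] := psub_chain hH hA sp ss.
  have svE n : star v * s n = s n.
    by have [_ ->] := sv n; have [[sq ->] _] := Ss n.
  have vE n : v * s n = s n.
    by have [] := sv n; have [[sq ->] _] := Ss n; rewrite sq.
  have vv : v * v = v.
    apply/eqP; rewrite -subr_eq0 -{3}[v]mul1r -mulrBl -[_ * v]mulr1; apply/eqP/limv => n.
    by rewrite mulr1 mulrBl mul1r vE subrr.
  have svv : star v * v = v.
    apply/eqP; rewrite -subr_eq0 -{3}[v]mul1r -mulrBl -[_ * v]mulr1; apply/eqP/limv => n.
    by rewrite mulr1 mulrBl mul1r svE subrr.
  exists v => //; split; first by split=> //; rewrite -svv sM sK.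
  move=> y; rewrite -mulrA -[v]mul1r; apply: limv => n.
  by rewrite mul1r mulrA; have [_ ->] := Ss n.
(* Otherwise the right support of [x * (1 - z)], which also lies in [J] and is orthogonal to [z],
   could be added to [z]. *)
have absorb x : J x -> x * z = x.
  move=> Jx; have Jx' : J (x * (1 - z)).
    by move=> y; rewrite mulrBr mulr1 !mulrBl Jx -(mulrA x) -mulrA Jz mulr0 subrr.
  have [v [h1 h2 h3 _ _]] := polar hH hA (x * (1 - z)).
  have Je : J (star v * v).
    by move=> y; rewrite -!mulrA (mulrA v) [X in star v * X](_ : _ = 0) ?mulr0 // -mulrA;
       apply: h3; rewrite mulrA Jx'.
  have ez : star v * v * z = 0.
    by rewrite -mulrA h3 ?mulr0 // -mulrA mulrBl mul1r zz subrr mulr0.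
  have [ee se] := pisom_proj h1.
  have ze : z * (star v * v) = 0 by rewrite -[LHS]sK sM sz se ez (star0 hA).
  have Sze : S (z + star v * v).
    split; last by move=> y; rewrite !mulrDl Jz Je addr0.
    split; last by rewrite sD sz se.
    by rewrite mulrDl !mulrDr zz ez ze ee add0r addr0.
  have : z + star v * v = z.
    apply: zmax => //; rewrite /psub sz sD sz se zz.
    by rewrite mulrDl zz ez addr0.
  rewrite -[RHS]addr0 => /addrI e0.
  have : x * (1 - z) = 0 by rewrite -h2 e0 mulr0.
  by rewrite mulrBr mulr1 => /eqP; rewrite subr_eq0 => /eqP <-.
(* [z * m] lies in [J], so [z * m * z = z * m]; the adjoint of this relation for [star m] is
   [z * m * z = m * z]. *)
have comm m : z * m = m * z.
  have zm (m' : A) : z * m' * z = z * m'.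
    by apply: absorb => y; rewrite -(mulrA z) Jz.
  have := congr1 star (zm (star m)); rewrite !sM sz sK => h'.
  by rewrite -h' mulrA zm.
have [a za] := center_scalar hT comm.
have qz : q * z = q by exact: absorb.
have [a0|an0] := eqVneq a 0.
  by move: q0; rewrite -qz za a0 scale0r mulr0 eqxx.
have zn0 : z != 0 by apply: contra_neq q0 => z0; rewrite -qz z0 mulr0.
have z1 : z = 1.
  have : a *: z = a *: 1 by rewrite -za -{2}zz {2}za -scalerAl mul1r.
  by move/(congr1 (fun t => a^-1 *: t)); rewrite !scalerA mulVf // !scale1r.
by move: p0; rewrite -[p]mul1r -(mulr1 1) -z1 Jz eqxx.
Qed.

Lemma pisom_orthD v w : pisom v -> pisom w -> star v * w = 0 -> v * star w = 0 ->
  pisom (v + w) /\ sub v (v + w).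
Proof.
move=> hv hw vw vw'.
have wv : star w * v = 0 by rewrite -[LHS]sK sM sK vw (star0 hA).
have wv' : w * star v = 0 by rewrite -[LHS]sK sM sK vw' (star0 hA).
have E : star (v + w) * (v + w) = star v * v + star w * w.
  by rewrite sD mulrDl !mulrDr vw wv addr0 add0r.
split; last split.
- by rewrite -mulrA E mulrDl !mulrDr !mulrA hv hw wv' vw' !mul0r addr0 add0r.
- by rewrite mulrDl !mulrA hv wv' mul0r addr0.
- by rewrite sD mulrDl wv addr0.
Qed.

(** Take [v] maximal from a part of [p] to a part of [q]. If both remainders were nonzero,
    [proj_connected] would give a nonzero element between them, whose polar part could be added to
    [v]. *)
Lemma comparison p q : prj p -> prj q ->
  (exists v, star v * v = p /\ q * v = v) \/ (exists v, star v * v = q /\ p * v = v).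
Proof.
move=> hp hq.
have [[pp sp] [qq sq]] := (hp, hq).
pose S := [set v | [/\ pisom v, q * v = v & v * p = v]].
have [| | |v [hv qv vp] vmax] := @maximal_pisom S.
- by exists 0; rewrite /S /= !(mulr0, mul0r).
- by move=> v [].
- move=> s Ss ss; have sp' n : pisom (s n) by have [] := Ss n.
  have [v [pv sv limv]] := psub_chain hH hA sp' ss.
  exists v => //; split=> //; apply/eqP; rewrite -subr_eq0; apply/eqP.
    rewrite -{2}[v]mul1r -mulrBl -[_ * v]mulr1; apply: limv => n.
    by rewrite mulr1 mulrBl mul1r; have [_ -> _] := Ss n; rewrite subrr.
  rewrite -{2}[v]mulr1 -mulrBr -{1}[v]mul1r; apply: limv => n.
  by rewrite mul1r mulrBr mulr1; have [_ _ ->] := Ss n; rewrite subrr.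
have qv' : star v * q = star v by rewrite -[LHS]sK sM sK sq qv.
have vp' : p * star v = star v by rewrite -[LHS]sK sM sK sp vp.
have hp1 : prj (p - star v * v).
  by apply: projB => //; [exact: pisom_proj | rewrite mulrA vp'].
have hq1 : prj (q - v * star v).
  by apply: projB => //; [exact: pisom_projV | rewrite mulrA qv].
have [p10|p1] := eqVneq (p - star v * v) 0.
  by left; exists v; split=> //; apply/eqP; rewrite eq_sym -subr_eq0 p10.
have [q10|q1] := eqVneq (q - v * star v) 0.
  by right; exists (star v); split=> //; rewrite sK; apply/eqP; rewrite eq_sym -subr_eq0 q10.
have [x /eqP xn0] := proj_connected hp1 hq1 p1 q1; exfalso; apply: xn0.
set y := _ * _ * _; have [w [hw h2 h3 h4 _]] := polar hH hA y.
have wp1 : w * (p - star v * v) = w.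
  apply/eqP; rewrite -subr_eq0 -{2}[w]mulr1 -mulrBr; apply/eqP/h3.
  by rewrite mulrBr mulr1 /y -!mulrA hp1.1 subrr.
have qw1 : (q - v * star v) * w = w by apply: h4; rewrite /y !mulrA hq1.1.
have vw : star v * w = 0.
  by rewrite -qw1 mulrA mulrBr qv' mulrA pisom_star // subrr mul0r.
have vw' : v * star w = 0.
  by rewrite -wp1 sM hp1.2 mulrA mulrBr vp mulrA hv subrr mul0r.
have [hvw svw] := pisom_orthD hv hw vw vw'.
have qw : q * w = w by rewrite -qw1 mulrA mulrBr qq mulrA qv.
have wp : w * p = w by rewrite -wp1 -mulrA mulrBl pp -mulrA vp.
have Svw : S (v + w) by split=> //; rewrite ?mulrDr ?mulrDl ?qv ?qw ?vp ?wp.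
have := vmax _ Svw svw; rewrite -[RHS]addr0 => /addrI w0.
by rewrite -h2 w0 !mulr0.
Qed.

(** If every nonzero projection had trace above [tr p / 2], a proper part of [p] and its complement
    in [p] would together exceed [tr p]. So [p] would be minimal, its corner scalar, and [p]
    abelian. *)
Lemma proj_half p : prj p -> p != 0 ->
  exists q, [/\ prj q, q != 0 & tr q <= tr p / 2].
Proof.
move=> hp p0; apply: contrapT => /forallNP h.
have {}h q : prj q -> q != 0 -> tr p / 2 < tr q.
  by move=> hq q0; rewrite ltNge; apply/negP => le; exact: (h q).
have min q : prj q -> q * p = q -> q = 0 \/ q = p.
  move=> hq qp; have [q0|q0] := eqVneq q 0; [by left | right].
  have pq : p * q = q by rewrite -[LHS](starK hA) sM hq.2 hp.2 qp hq.2.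
  apply/eqP; rewrite eq_sym -subr_eq0; apply/negP => /negP pq0.
  by have := h _ hq q0; have := h _ (projB hp hq pq) pq0; rewrite trB; lra.
move/eqP: p0; apply; apply: (no_abelian hT hp) => x y.
have [c ->] := minimal_scalar hH hA hp min x.
have [d ->] := minimal_scalar hH hA hp min y.
by rewrite -!scalerAl -!scalerAr scalerA mulrC -scalerA.
Qed.

Lemma proj_small (eps : R) : 0 < eps -> exists e, [/\ prj e, e != 0 & tr e < eps].
Proof.
move=> eps0.
have small n : exists e, [/\ prj e, e != 0 & tr e * n%:R <= 1].
  elim: n => [|n [e [he e0 le]]].
    by exists 1; split; [exact: proj_one | exact: oner_neq0 | rewrite mulr0].
  have [q [hq q0 le2]] := proj_half he e0; exists q; split=> //.
  have := proj_tr_gt0 hq q0; have := proj_tr_gt0 he e0; have := proj_tr_le1 he.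
  move: le; rewrite -[n.+1%:R]natr1.
  have : 0 <= n%:R :> R by [].
  move: (n%:R : R) => N; nra.
have q0 : 0 <= eps^-1 by rewrite invr_ge0 ltW.
have := archi_boundP q0; set n := Num.bound _ => hn.
have [e [he e0 le]] := small n; exists e; split=> //.
have n0 : 0 < n%:R :> R by apply: lt_trans hn; rewrite invr_gt0.
rewrite -(ltr_pM2r n0); apply: le_lt_trans le _.
by rewrite -(ltr_pM2l eps0) divff ?gt_eqF in hn.
Qed.

(** Division of [p] by [e] with remainder. While a copy of [e] fits into what is left, it is split
    off and the trace drops by [tr e]; otherwise what is left is equivalent to the part [star t * t]
    of [e]. *)
Lemma packing e p : prj e -> e != 0 -> prj p ->
  exists (vs : seq A) (t : A),
    [/\ forall v, v \in vs -> star v * v = e /\ p * v = v, t * star t * t = t,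
        star t * t * e = star t * t &
        \sum_(v <- vs) v * star v + t * star t = p].
Proof.
move=> he e0 hp; have te := proj_tr_gt0 he e0.
have q0 : 0 <= tr p / tr e by rewrite divr_ge0 ?proj_tr_ge0.
have := archi_boundP q0; move: (Num.bound _) => n; rewrite ltr_pdivrMr //.
elim: n p hp {q0} => [|n ih] p hp.
  by rewrite mul0r ltNge proj_tr_ge0.
move=> lt; have [[w [ww ew]]|[v [vv pv]]] := comparison hp he.
  exists [::], (star w); rewrite big_nil add0r sK ww.
  have hw : pisom w by apply: pisom_of_proj; rewrite ww.
  have we : star w * e = star w by rewrite -[LHS]sK sM sK he.2 ew.
  by split=> //; [rewrite -ww pisom_star | rewrite -mulrA we].
have hv : pisom v by apply: pisom_of_proj; rewrite vv.
have [| |vs [t [h1 h2 h3 h4]]] := ih (p - v * star v).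
- by apply: projB => //; [exact: pisom_projV | rewrite mulrA pv].
- by rewrite trB (trC hT) vv; move: lt; rewrite -[n.+1%:R]natr1; lra.
exists (v :: vs), t; split=> //.
  move=> w; rewrite inE => /orP[/eqP -> //|/h1 [ww pw]]; split=> //.
  by rewrite -pw mulrA mulrBr hp.1 mulrA pv.
by rewrite big_cons -addrA h4 addrC subrK.
Qed.

End Comparison.

(** * Encoding blocks in few self-adjoint elements *)

Section Encoding.
Context {R : realType} {H : completeNormedModType R[i]}.
Variable dot : {dot H for (@Num.conj R[i])}.
Variables (A : algType R[i]) (act : A -> H -> H) (star : A -> A) (tr : A -> R).
Hypotheses (hA : star_rep dot act star) (hT : tracial_factor star tr).
Implicit Types (x y z p q e v w : A).

Local Notation prj := (proj star).
Local Notation pisom v := (v * star v * v = v).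
Let sK := starK hA. Let sM := starM hA. Let sB := starB hA. Let sD := starD hA.

Lemma star_sum (I : Type) (r : seq I) (Q : pred I) (F : I -> A) :
  star (\sum_(i <- r | Q i) F i) = \sum_(i <- r | Q i) star (F i).
Proof. exact: (big_morph star sD (star0 hA)). Qed.

(** No unit, because the algebras defining [Wstar] need not contain the identity, and no closure,
    because the entries are read off algebraically. *)
Record star_subalgebra (B : set A) : Prop := {
  sub_lin : forall (a : R[i]) x y, B x -> B y -> B (a *: x + y) ;
  sub_mul : forall x y, B x -> B y -> B (x * y) ;
  sub_star : forall x, B x -> B (star x) ;
  sub_zero : B 0 }.

Lemma sub_sum B (I : eqType) (r : seq I) (F : I -> A) : star_subalgebra B ->
  (forall i, i \in r -> B (F i)) -> B (\sum_(i <- r) F i).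
Proof.
move=> hB; elim: r => [|i r ih] h; first by rewrite big_nil; exact: sub_zero.
rewrite big_cons -[F i]scale1r; apply: (sub_lin hB); first by apply: h; rewrite mem_head.
by apply: ih => j jr; apply: h; rewrite in_cons jr orbT.
Qed.

Lemma subB B x y : star_subalgebra B -> B x -> B y -> B (x - y).
Proof. by move=> hB Bx By; rewrite addrC -scaleN1r; exact: (sub_lin hB). Qed.

Lemma subZ B (a : R[i]) x : star_subalgebra B -> B x -> B (a *: x).
Proof.
move=> hB Bx; rewrite -[_ *: _]addr0.
by apply: (sub_lin hB) => //; exact: sub_zero.
Qed.

Section Diagonal.
Variables (f : nat -> A) (M : nat).
Hypothesis ff : forall i j, (i < M)%N -> (j < M)%N ->
  f i * f j = if i == j then f i else 0.

Let diag (c : nat -> R[i]) := \sum_(j < M) c j *: f j.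

Lemma diagM c d : diag c * diag d = diag (fun j => c j * d j).
Proof.
rewrite /diag mulr_suml; apply: eq_bigr => i _.
rewrite mulr_sumr (bigD1 i) //= big1 ?addr0.
  by rewrite -scalerAl -scalerAr ff // eqxx scalerA.
move=> j ji; rewrite -scalerAl -scalerAr ff // eq_sym (inj_eq val_inj) (negPf ji).
by rewrite !scaler0.
Qed.

(* The projections [f i] are polynomials without constant term in a linear
   combination with distinct nonzero coefficients. *)
Lemma diag_sub B i : star_subalgebra B -> (i < M)%N ->
  B (\sum_(j < M) (j.+1%:R : R[i]) *: f j) -> B (f i).
Proof.
move=> hB iM Bh.
(* A Lagrange polynomial built factor by factor. The leading [j.+1] removes the constant term, as
   [B] may lack the unit; it does not vanish because the coefficients start at 1. *)
have key (r : seq nat) :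
    B (diag (fun j => j.+1%:R * \prod_(k <- r | k != i) (j.+1%:R - k.+1%:R))).
  elim: r => [|k r ih].
    by rewrite (_ : diag _ = diag (fun j => j.+1%:R)) //; apply: eq_bigr => j _;
       rewrite big_nil mulr1.
  have [ki|ki] := eqVneq k i.
    rewrite (_ : diag _ = diag (fun j =>
        j.+1%:R * \prod_(k <- r | k != i) (j.+1%:R - k.+1%:R))) //.
    by apply: eq_bigr => j _; rewrite big_cons ki eqxx.
  set D := diag _ in ih; rewrite (_ : diag _ = D * diag (fun j => j.+1%:R) - k.+1%:R *: D).
    by apply: subB => //; [exact: (sub_mul hB) | exact: subZ].
  rewrite /D diagM scaler_sumr -sumrB; apply: eq_bigr => j _.
  by rewrite big_cons ki scalerA -scalerBl; congr (_ *: _); ring.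
have := key (iota 0 M); set c := fun j => _.
have -> : diag c = c i *: f i.
  rewrite /diag (bigD1 (Ordinal iM)) //= big1 ?addr0 // => j ji.
  rewrite /c (big_rem (j : nat)) /=; last by rewrite mem_iota /=.
  rewrite (_ : (j : nat) != i) ?subrr ?mul0r ?mulr0 ?scale0r //.
move=> Bc; have ci : c i != 0.
  rewrite mulf_neq0 ?pnatr_eq0 // prodf_seq_neq0; apply/allP => k _; apply/implyP => ki.
  by rewrite subr_eq0 eqr_nat eqSS eq_sym.
by rewrite -[f i](scalerK ci); apply: subZ.
Qed.

End Diagonal.

(** [iota 1 b.-1] runs from 1 to [b - 1], which leaves [(m - 1) (m - 2) / 2] pairs once index 0 is
    reserved for the links. *)
Definition slot_pairs (m : nat) : seq (nat * nat) :=
  [seq (a, b) | b <- iota 0 m, a <- iota 1 b.-1].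

Lemma slot_pairsP m a b : ((a, b) \in slot_pairs m) = (0 < a < b)%N && (b < m)%N.
Proof.
apply/allpairsPdep/idP => [[b' [a' [hb ha [-> ->]]]]|/andP[/andP[a0 ab] bm]].
  move: hb ha; rewrite !mem_iota /= add0n => ->; lia.
by exists b, a; rewrite !mem_iota; split=> //; lia.
Qed.

Lemma slot_pairs_uniq m : uniq (slot_pairs m).
Proof.
apply: allpairs_uniq_dep; [exact: iota_uniq | by move=> b _; exact: iota_uniq|].
by move=> [b a] [b' a'] _ _ [-> ->].
Qed.

Lemma size_slot_pairs m : (2 * size (slot_pairs m) = m.-1 * m.-2)%N.
Proof.
rewrite size_allpairs_dep; elim: m => // m ih.
rewrite -[m.+1]addn1 iotaD map_cat sumn_cat mulnDr ih /= add0n size_iota.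
by rewrite addn0; case: m {ih} => [|[|m]] //=; lia.
Qed.

Definition slots (n m : nat) : seq (nat * (nat * nat)) :=
  [seq (c, s) | c <- iota 0 n, s <- slot_pairs m].

Lemma slots_uniq n m : uniq (slots n m).
Proof.
apply: allpairs_uniq; [exact: iota_uniq | exact: slot_pairs_uniq|].
by move=> [c s] [c' s'] _ _ [-> ->].
Qed.

Lemma size_slots n m : (2 * size (slots n m) = n * (m.-1 * m.-2))%N.
Proof. by rewrite size_allpairs size_iota mulnCA size_slot_pairs. Qed.

(* The blocks [t i A (t j)^*], for [i, j < M], form a matrix decomposition of
   [A]; the first [m] diagonal corners are copies of [e], the others of
   subprojections of [e]. The elements of [Z] are stored in the positions
   [0 < a < b < m] of [n] self-adjoint elements, while row and column [0] of
   each hold the partial isometries [t i (t 0)^*]. *)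
Section Generators.
Variables (e : A) (t : nat -> A) (M m n : nat) (Z : seq A).
Hypotheses (he : prj e) (m0 : (0 < m)%N) (mM : (m <= M)%N).
Hypothesis tt : forall i j, (i < M)%N -> (j < M)%N -> i != j -> star (t i) * t j = 0.
Hypothesis tp : forall i, (i < M)%N -> pisom (t i).
Hypothesis tm : forall i, (i < m)%N -> star (t i) * t i = e.
Hypothesis te : forall i, (i < M)%N -> t i * e = t i.
Hypothesis t1 : \sum_(i < M) t i * star (t i) = 1.
Hypothesis Ze : forall z, z \in Z -> e * z * e = z.
Hypothesis Zn : (size Z <= size (slots n m))%N.

Let f i := t i * star (t i).

(** The rank of a slot is its address in [Z]; slots past the end of [Z], in particular those with
    [c >= n], hold 0. *)
Let fill c s := nth 0 Z (index (c, s) (slots n m)).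

Definition link := \sum_(1 <= j < M) t j * star (t 0).
Definition blocks c :=
  \sum_(s <- slot_pairs m) t s.1 * fill c s * star (t s.2).

Definition generator (c : nat) : A :=
  if c is c'.+1 then (link + star link) + (blocks c' + star (blocks c'))
  else \sum_(j < M) (j.+1%:R : R[i]) *: f j.

Lemma star_f i : star (f i) = f i.
Proof. by rewrite /f sM sK. Qed.

Lemma generator_selfadjoint c : star (generator c) = generator c.
Proof.
case: c => [|c] /=; last by rewrite !sD !sK [star link + _]addrC [star (blocks c) + _]addrC.
rewrite star_sum; apply: eq_bigr => j _.
by rewrite (starZ hA) star_f; congr (_ *: _); exact: conjc_nat.
Qed.

Lemma fillE c s : e * fill c s * e = fill c s.
Proof.
rewrite /fill; have [lt|ge] := ltnP (index (c, s) (slots n m)) (size Z).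
  by apply: Ze; exact: mem_nth.
by rewrite nth_default // mulr0 mul0r.
Qed.

Let M0 : (0 < M)%N. Proof. exact: leq_trans m0 mM. Qed.

(** This and the next lemmas compute entries [star (t i) * _ * t j]. The four summands of a
    generator have disjoint supports: [link] is in column 0 below the diagonal, its adjoint in row
    0, the blocks strictly above the diagonal outside row 0, their adjoints below it outside column
    0. *)
Lemma link0 i : (0 < i < M)%N -> star (t i) * link * t 0 = star (t i) * t i.
Proof.
move=> /andP[i0 iM]; rewrite /link mulr_sumr mulr_suml.
rewrite (bigD1_seq i) ?iota_uniq //=; last first.
  by rewrite mem_index_iota i0.
rewrite !mulrA -(mulrA _ (star (t 0))) (tm m0) -mulrA te // big_seq_cond big1 ?addr0 //.
move=> j /andP[]; rewrite mem_index_iota => /andP[_ jM] ji.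
by rewrite !mulrA tt // 1?eq_sym // !mul0r.
Qed.

Lemma link_eq0 i j : (i < M)%N -> (0 < j < M)%N -> star (t i) * link * t j = 0.
Proof.
move=> iM /andP[j0 jM]; rewrite /link mulr_sumr mulr_suml big_seq big1 // => k _.
by rewrite -!mulrA tt ?mulr0 // eq_sym -lt0n.
Qed.

Lemma star_link_eq0 i j : (0 < i < M)%N -> (j < M)%N -> star (t i) * star link * t j = 0.
Proof.
move=> hi jM; have := congr1 star (link_eq0 jM hi).
by rewrite !sM sK (star0 hA) mulrA.
Qed.

Lemma blocks_eq0 c i : (i < M)%N -> star (t i) * blocks c * t 0 = 0.
Proof.
move=> iM; rewrite /blocks mulr_sumr mulr_suml big_seq big1 // => -[a b].
rewrite slot_pairsP => /andP[/andP[a0 ab] bm] /=.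
rewrite -!mulrA tt ?mulr0 //; first exact: leq_trans bm mM.
by rewrite -lt0n; exact: leq_trans ab.
Qed.

Lemma star_blocks_eq0 c i : (i < M)%N -> star (t i) * star (blocks c) * t 0 = 0.
Proof.
move=> iM; rewrite /blocks star_sum mulr_sumr mulr_suml big_seq big1 // => -[a b].
rewrite slot_pairsP => /andP[/andP[a0 ab] bm] /=.
rewrite !sM !sK -!mulrA tt ?mulr0 //; last by rewrite -lt0n.
exact: ltn_trans ab (leq_trans bm mM).
Qed.

Lemma blocksE c a b : (0 < a < b)%N -> (b < m)%N ->
  star (t a) * blocks c * t b = fill c (a, b).
Proof.
move=> hab bm; have bM : (b < M)%N by exact: leq_trans bm mM.
have aM : (a < M)%N by case/andP: hab => _ /ltn_trans; apply.
have am : (a < m)%N by case/andP: hab => _ /ltn_trans; apply.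
rewrite /blocks mulr_sumr mulr_suml (bigD1_seq (a, b)) ?slot_pairs_uniq //=; last first.
  by rewrite slot_pairsP hab.
rewrite !mulrA tm // -mulrA tm // fillE big_seq_cond big1 ?addr0 // => -[a' b'] /andP[].
rewrite slot_pairsP => /andP[/andP[a0 ab] bm'] ne /=.
have b'M : (b' < M)%N by exact: leq_trans bm' mM.
have a'M : (a' < M)%N by exact: ltn_trans ab b'M.
have [aa|aa] := eqVneq a a'; last by rewrite !mulrA tt // !mul0r.
have bb : b' != b by apply: contra_neq ne => ->; rewrite aa.
by rewrite -!mulrA tt // !mulr0.
Qed.

Lemma star_blocksE c a b : (0 < a < b)%N -> (b < m)%N ->
  star (t a) * star (blocks c) * t b = 0.
Proof.
move=> /andP[a0 ab] bm; have bM : (b < M)%N by exact: leq_trans bm mM.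
have aM : (a < M)%N by exact: ltn_trans ab bM.
rewrite /blocks star_sum mulr_sumr mulr_suml big_seq big1 // => -[a' b'].
rewrite slot_pairsP => /andP[/andP[a0' ab'] bm'] /=.
have b'M : (b' < M)%N by exact: leq_trans bm' mM.
have a'M : (a' < M)%N by exact: ltn_trans ab' b'M.
rewrite !sM !sK; have [aa|aa] := eqVneq a b'; last by rewrite !mulrA tt // !mul0r.
by rewrite -!mulrA tt ?mulr0 //; lia.
Qed.

Lemma generator_link c i : (0 < i < M)%N ->
  star (t i) * generator c.+1 * t 0 = star (t i) * t i.
Proof.
move=> hi; have iM : (i < M)%N by case/andP: hi.
rewrite /= !mulrDr !mulrDl link0 // star_link_eq0 // blocks_eq0 // star_blocks_eq0 //.
by rewrite !addr0.
Qed.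

Lemma generator_slot c a b : (0 < a < b)%N -> (b < m)%N ->
  star (t a) * generator c.+1 * t b = fill c (a, b).
Proof.
move=> hab bm; have bM : (b < M)%N by exact: leq_trans bm mM.
have aM : (a < M)%N by case/andP: hab => _ /ltn_trans; apply.
rewrite /= !mulrDr !mulrDl link_eq0 //; last by apply/andP; split => //; lia.
rewrite star_link_eq0 //; last by apply/andP; split => //; lia.
by rewrite blocksE // star_blocksE // !add0r addr0.
Qed.

(** The diagonal element yields the [f i]; cutting [generator 1] by them, whence [0 < n], yields the
    [t i * star (t 0)]; these move a stored entry from its slot to any place, and [x] is the sum of
    its entries. *)
Lemma generators_generate (B : set A) x : (0 < n)%N -> star_subalgebra B ->
  (forall c, (c <= n)%N -> B (generator c)) ->
  (forall j k, (j < M)%N -> (k < M)%N -> star (t j) * x * t k != 0 ->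
     star (t j) * x * t k \in Z) -> B x.
Proof.
move=> n0 hB Bg hx.
have Bf i : (i < M)%N -> B (f i).
  move=> iM; apply: (@diag_sub f M) => //; last exact: (Bg 0%N).
  move=> j k jM kM; rewrite /f; have [->|jk] := eqVneq j k.
    by rewrite mulrA tp.
  by rewrite mulrA -(mulrA (t j)) tt // mulr0 mul0r.
have Bt0 i : (i < M)%N -> B (t i * star (t 0)).
  move=> iM; have [->|i0] := eqVneq i 0%N; first exact: Bf.
  have -> : t i * star (t 0) = f i * generator 1 * f 0.
    rewrite /f -!mulrA (mulrA (star (t i))) (mulrA _ (t 0)) generator_link; last first.
      by rewrite lt0n i0.
    by rewrite !mulrA tp.
  by apply: (sub_mul hB); [apply: (sub_mul hB); [exact: Bf | exact: Bg] | exact: Bf].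
have Bt i j : (i < M)%N -> (j < M)%N -> B (t i * star (t j)).
  move=> iM jM; have -> : t i * star (t j) = t i * star (t 0) * star (t j * star (t 0)).
    by rewrite sM sK mulrA -(mulrA (t i)) tm // te.
  by apply: (sub_mul hB); [exact: Bt0 | apply: (sub_star hB); exact: Bt0].
have Bz z j k : z \in Z -> (j < M)%N -> (k < M)%N -> B (t j * z * star (t k)).
  move=> zZ jM kM; pose i := index z Z.
  have iZ : (i < size Z)%N by rewrite index_mem.
  have iS : (i < size (slots n m))%N by exact: leq_trans Zn.
  pose s := nth (0, (0, 0))%N (slots n m) i.
  have sS : s \in slots n m by exact: mem_nth.
  have zE : z = fill s.1 (s.2.1, s.2.2).
    by rewrite /fill -!surjective_pairing index_uniq ?slots_uniq // nth_index.
  move: sS; case/allpairsP => -[c [a b]] /= [cn hab sE].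
  rewrite sE /= in zE; move: hab cn; rewrite slot_pairsP mem_iota add0n => /andP[hab bm] cn.
  have bM : (b < M)%N by exact: leq_trans bm mM.
  have am : (a < m)%N by case/andP: hab => _ /ltn_trans; apply.
  have aM : (a < M)%N by exact: leq_trans am mM.
  have -> : t j * z * star (t k) =
      t j * star (t a) * (f a * generator c.+1 * f b) * (t b * star (t k)).
    have -> : f a * generator c.+1 * f b = t a * z * star (t b).
      rewrite /f zE -(generator_slot c hab bm) !mulrA.
      done.
    have ze : z * e = z by rewrite -(Ze zZ) -mulrA he.1.
    have E : t j * star (t a) * t a = t j by rewrite -mulrA tm // te.
    by rewrite !mulrA E -(mulrA (t j * z)) tm // -[t j * z * e]mulrA ze.
  apply: (sub_mul hB); last exact: Bt.
  apply: (sub_mul hB); first exact: Bt.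
  by apply: (sub_mul hB); [apply: (sub_mul hB); [exact: Bf | exact: Bg] | exact: Bf].
rewrite -[x]mulr1 -[x]mul1r -t1 mulr_suml mulr_suml.
rewrite -(big_mkord xpredT (fun i => t i * star (t i) * x * \sum_(j < M) t j * star (t j))).
apply: sub_sum => // j; rewrite mem_index_iota => jM.
rewrite mulr_sumr -(big_mkord xpredT (fun k => t j * star (t j) * x * (t k * star (t k)))).
apply: sub_sum => // k; rewrite mem_index_iota => kM.
have -> : t j * star (t j) * x * (t k * star (t k)) =
    t j * (star (t j) * x * t k) * star (t k).
  by rewrite !mulrA.
have [->|nz] := eqVneq (star (t j) * x * t k) 0.
  by rewrite mulr0 mul0r; exact: sub_zero.
by apply: Bz => //; exact: hx.
Qed.

End Generators.
End Encoding.

(** [I] is the intersection sum, [N] the number of generators, [s] that of pieces, [m] that of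
    copies of a projection of trace [eps], [z] that of nonzero entries. Multiplied by [eps ^+ 2],
    the claim compares [2 * I] with [n] up to errors of order [eps]: [N * (2 * s + s ^+ 2)] stems
    from entries touching remainders, [n * (s + 2)] from [m * eps >= 1 - s * eps] and the shifts in
    [m - 1] and [m - 2]. *)
Lemma slot_estimate (F : realFieldType) (I N s n m eps z : F) :
  0 <= I -> 0 <= N -> 0 <= s -> 1 <= n -> 0 < eps -> eps < 1 ->
  eps * (N * (2 * s + s ^+ 2) + n * (s + 2) + 1) < n / 2 - I ->
  m * eps <= 1 -> 1 <= m * eps + s * eps ->
  z * eps ^+ 2 <= I + N * (2 * s * eps + s ^+ 2 * eps ^+ 2) ->
  0 < m /\ 2 * z <= n * ((m - 1) * (m - 2)).
Proof.
move=> I0 N0 s0 n1 eps0 e1 eK meps meps' Zle.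
have N2 : 0 <= N * (2 * s + s ^+ 2) by rewrite mulr_ge0 // addr_ge0 ?mulr_ge0 ?sqr_ge0.
have small : eps * (s + 2) < 1 / 2.
  rewrite -(ltr_pM2l (lt_le_trans ltr01 n1)).
  by have := mulr_ge0 (ltW eps0) N2; move: eK; lra.
split.
  by rewrite -(pmulr_lgt0 _ eps0); lra.
rewrite -(ler_pM2r (exprn_gt0 2 eps0)).
have -> : n * ((m - 1) * (m - 2)) * eps ^+ 2 =
    n * ((m * eps - eps) * (m * eps - 2 * eps)) by ring.
set a := m * eps in meps meps' *.
have a1 : 1 - eps * (s + 2) <= a - 2 * eps by lra.
have a2 : 1 - 2 * (eps * (s + 2)) <= (a - eps) * (a - 2 * eps).
  apply: (@le_trans _ _ ((1 - eps * (s + 2)) * (1 - eps * (s + 2)))).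
    by have := sqr_ge0 (eps * (s + 2)); rewrite expr2; lra.
  by apply: ler_pM => //; lra.
apply: (@le_trans _ _ (n * (1 - 2 * (eps * (s + 2))))); last first.
  by rewrite ler_wpM2l // (le_trans ler01).
have e2 : N * s ^+ 2 * eps ^+ 2 <= N * s ^+ 2 * eps.
  by apply: ler_wpM2l; [rewrite mulr_ge0 ?sqr_ge0 | rewrite expr2; nra].
by move: Zle eK; lra.
Qed.

(** * Counting the nonzero entries *)

Section Counting.
Context {R : realType} {H : completeNormedModType R[i]}.
Variable dot : {dot H for (@Num.conj R[i])}.
Variables (A : algType R[i]) (act : A -> H -> H) (star : A -> A) (tr : A -> R).
Hypotheses (hH : hilbert_space dot) (hA : star_rep dot act star).
Hypothesis hT : tracial_factor star tr.
Implicit Types (x y z p q e v w : A) (S : seq A).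

Local Notation prj := (proj star).
Local Notation pisom v := (v * star v * v = v).
Let sK := starK hA. Let sM := starM hA. Let sB := starB hA. Let sD := starD hA.

Lemma sum_cst (I : Type) (r : seq I) (c : R) :
  \sum_(i <- r) c = (size r)%:R * c.
Proof. by rewrite big_const_seq count_predT iter_addr addr0 mulr_natl. Qed.

(** The [star (y k) * y k] with [y k = star (t k) * t j] add up to [star (t j) * t j], which the
    term [k = j] already exhausts; the other terms have trace 0. *)
Lemma partition_orth (t : nat -> A) M i j :
  (forall k, (k < M)%N -> pisom (t k)) -> \sum_(k < M) t k * star (t k) = 1 ->
  (i < M)%N -> (j < M)%N -> i != j -> star (t i) * t j = 0.
Proof.
move=> tp t1 iM jM ij; apply: (tr_eq0 hT).
pose y k := star (t k) * t j.
have E : \sum_(k < M) tr (star (y k) * y k) = tr (star (y j) * y j).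
  have yj : star (y j) * y j = star (t j) * 1 * t j.
    by rewrite mulr1 /y sM sK -mulrA (mulrA (t j)) tp.
  rewrite yj -t1 mulr_sumr mulr_suml (tr_sum hT); apply: eq_bigr => k _.
  by rewrite /y sM sK !mulrA.
have := E; rewrite (bigD1 (Ordinal jM)) //= => /eqP.
rewrite -subr_eq0 addrAC subrr add0r => /eqP/psumr_eq0P h.
by apply: (h _ (Ordinal iM)) => // k _; exact: tr_ge0 hT _.
Qed.

Let blk x v w : R := (star v * x * w != 0)%:R.

Lemma blk_le1 x v w : blk x v w <= 1.
Proof. by rewrite /blk; case: (_ != _). Qed.

Lemma sum_blk_le x S S' :
  \sum_(v <- S) \sum_(w <- S') blk x v w <= (size S)%:R * (size S')%:R.
Proof.
rewrite -sum_cst; apply: ler_sum => v _; rewrite -[X in _ <= X]mulr1 -sum_cst.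
by apply: ler_sum => w _; exact: blk_le1.
Qed.

Definition intersection_sum (X P : seq A) : R :=
  \sum_(x <- X) \sum_(p <- P) \sum_(q <- P)
    (if p * x * q != 0 then tr p * tr q else 0).

(** The quantification over [B] allows an application to each weakly closed algebra containing the
    [h c]; their intersection is [Wstar]. *)
Lemma few_generators (X P : seq A) (n : nat) :
  (forall p, p \in P -> prj p) -> \sum_(p <- P) p = 1 ->
  intersection_sum X P < n%:R / 2 ->
  exists h : nat -> A, (forall c, star (h c) = h c) /\
    forall B : set A, star_subalgebra star B -> (forall c, (c <= n)%N -> B (h c)) ->
    forall x, x \in X -> B x.
Proof.
move=> hP P1 hI.
have I0 : 0 <= intersection_sum X P.
  apply: sumr_ge0 => x _; rewrite big_seq; apply: sumr_ge0 => p /hP pp.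
  rewrite big_seq; apply: sumr_ge0 => q /hP qq; case: ifP => // _.
  by rewrite mulr_ge0 // (proj_tr_ge0 hT).
have n0 : (0 < n)%N.
  by rewrite lt0n; apply/eqP => n0; move: hI; rewrite n0 mul0r; lra.
set I := intersection_sum X P in hI I0.
pose N : R := (size X)%:R; pose s : R := (size P)%:R; pose nr : R := n%:R.
have N0 : 0 <= N by [].
have s0 : 0 <= s by [].
have nr0 : 0 <= nr by [].
(* The error terms of [slot_estimate], plus 1 to make the divisor positive. The minimum with 1 below
   gives [eps < 1], so that [eps ^+ 2 <= eps]. *)
pose K := N * (2 * s + s ^+ 2) + nr * (s + 2) + 1.
have K0 : 0 < K by rewrite ltr_wpDl // addr_ge0 // mulr_ge0 // addr_ge0 // ?mulr_ge0 ?sqr_ge0.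
have d0 : 0 < Num.min 1 ((nr / 2 - I) / K).
  by rewrite lt_min ltr01 /=; apply: divr_gt0 => //; rewrite subr_gt0.
have [e [he e0]] := proj_small hH hA hT d0.
rewrite lt_min ltr_pdivlMr // => /andP[e1 eK].
set eps := tr e in e1 eK; have eps0 : 0 < eps by exact: (proj_tr_gt0 hT).
have [[ee se]] := he.
have ex p : exists vt : seq A * A, p \in P ->
    [/\ forall v, v \in vt.1 -> star v * v = e /\ p * v = v,
        vt.2 * star vt.2 * vt.2 = vt.2, star vt.2 * vt.2 * e = star vt.2 * vt.2 &
        \sum_(v <- vt.1) v * star v + vt.2 * star vt.2 = p].
  have [pP|pP] := boolP (p \in P); last by exists ([::], 0).
  by have [vs [t ht]] := packing hH hA hT he e0 (hP _ pP); exists (vs, t).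
have [vt hvt] := choice ex.
(* [V] collects the copies of [e] and [T] the single remainder of each piece; with [V] first, the
   indices below [m] are those of full copies. *)
pose V := flatten [seq (vt p).1 | p <- P]; pose T := [seq (vt p).2 | p <- P].
pose ts := V ++ T; pose t i := nth 0 ts i.
pose m := size V; pose M := size ts.
have sT : size T = size P by rewrite size_map.
have MmP : M = (m + size P)%N by rewrite /M size_cat sT.
have inV v : v \in V -> exists p, [/\ p \in P, v \in (vt p).1 & star v * v = e /\ p * v = v].
  case/flatten_mapP => p pP vp; exists p; split=> //.
  by have [h _ _ _] := hvt _ pP; exact: h.
have inT v : v \in T -> pisom v /\ star v * v * e = star v * v.
  by case/mapP => p pP ->; have [_ ? ? _] := hvt _ pP.
have ints v : v \in ts -> pisom v /\ v * e = v.
  rewrite mem_cat => /orP[/inV [p [_ _ [ve _]]]|/inT [hv ve]].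
    have hv : pisom v by apply: (pisom_of_proj hA hT); rewrite ve.
    by split=> //; rewrite -ve mulrA hv.
  by split=> //; rewrite -[v in LHS]hv -(mulrA v) -mulrA ve mulrA hv.
have sum_ts (F : A -> A) : \sum_(i < M) F (t i) = \sum_(v <- ts) F v.
  by rewrite (big_nth 0) big_mkord.
have t1 : \sum_(i < M) t i * star (t i) = 1.
  rewrite (sum_ts (fun v => v * star v)) /ts big_cat /V /T big_flatten !big_map /=.
  rewrite -big_split /= -P1.
  by rewrite big_seq [RHS]big_seq; apply: eq_bigr => p /hvt [].
have tts i : (i < M)%N -> t i \in ts by move=> iM; exact: mem_nth.
have tp i : (i < M)%N -> pisom (t i) by move=> /tts /ints [].
have te i : (i < M)%N -> t i * e = t i by move=> /tts /ints [].
have tm i : (i < m)%N -> star (t i) * t i = e.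
  move=> im; have : t i \in V by rewrite /t nth_cat im mem_nth.
  by move=> /inV [p [_ _ []]].
have trV : \sum_(v <- V) tr (v * star v) = m%:R * eps.
  rewrite big_seq (eq_bigr (fun=> eps)) => [|v /inV [p [_ _ [ve _]]]].
    by rewrite -big_seq sum_cst.
  by rewrite (trC hT) ve.
have trT0 : 0 <= \sum_(v <- T) tr (v * star v).
  by apply: sumr_ge0 => v _; rewrite (trC hT); exact: (tr_ge0 hT).
have trT : \sum_(v <- T) tr (v * star v) <= s * eps.
  rewrite /s -sT.
  rewrite -sum_cst big_seq [X in _ <= X]big_seq; apply: ler_sum => v /inT [hv ve].
  have hg := pisom_proj hA hv.
  have eg : e * (star v * v) = star v * v by rewrite -[LHS]sK sM se hg.2 ve hg.2.
  by have := proj_tr_ge0 hT (projB hA he hg eg); rewrite (trB hT) (trC hT v) subr_ge0.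
have tr_ts : m%:R * eps + \sum_(v <- T) tr (v * star v) = 1.
  by rewrite -trV -big_cat -(tr_sum hT) -(sum_ts (fun v => v * star v)) t1 (tr1 hT).
pose Z := [seq z <- [seq star vw.1 * x * vw.2 | x <- X, vw <- [seq (v, w) | v <- ts, w <- ts]]
          | z != 0].
have Ze z : z \in Z -> e * z * e = z.
  rewrite mem_filter => /andP[_ /allpairsP [[x [v w]] /= [_ + ->]]].
  move=> /allpairsP [[v' w'] /= [v'ts w'ts [-> ->]]].
  have [_ ve] := ints _ v'ts; have [_ we] := ints _ w'ts.
  have ve' : e * star v' = star v' by rewrite -[LHS]sK sM sK se ve.
  by rewrite !mulrA ve' -!mulrA we.
have sizeZ : (size Z)%:R = \sum_(x <- X) \sum_(v <- ts) \sum_(w <- ts) blk x v w.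
  rewrite -sum1_size big_filter big_mkcond natr_sum big_allpairs_dep /=.
  apply: eq_bigr => x _; rewrite big_allpairs_dep /=.
  by apply: eq_bigr => v _; apply: eq_bigr => w _; rewrite /blk; case: (_ != _).
(* An entry between a copy in [p] and a copy in [q] is zero whenever [p * x * q] is, and [p] holds
   at most [tr p / eps] copies. *)
have VV x : (\sum_(v <- V) \sum_(w <- V) blk x v w) * eps ^+ 2 <=
    \sum_(p <- P) \sum_(q <- P) (if p * x * q != 0 then tr p * tr q else 0).
  have szP p : p \in P -> (size (vt p).1)%:R * eps <= tr p.
    move=> pP; have [h1 _ _ h4] := hvt _ pP.
    rewrite -[in X in _ <= X]h4 (trD hT) (tr_sum hT) big_seq (eq_bigr (fun=> eps)).
      rewrite -big_seq sum_cst lerDl.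
      by rewrite (trC hT); exact: (tr_ge0 hT).
    by move=> v /h1 [ve _]; rewrite (trC hT) ve.
  have inner p q : p \in P -> q \in P ->
      (\sum_(v <- (vt p).1) \sum_(w <- (vt q).1) blk x v w) * eps ^+ 2 <=
      (if p * x * q != 0 then tr p * tr q else 0).
    move=> pP qP; case: eqP => [pxq|_] /=; last first.
      have h3 := sum_blk_le x (vt p).1 (vt q).1.
      have e2 : 0 <= eps ^+ 2 by exact: sqr_ge0.
      apply: le_trans (ler_wpM2r e2 h3) _; rewrite expr2 mulrACA.
      by apply: ler_pM; rewrite ?szP // mulr_ge0 // ltW.
    rewrite big_seq big1 ?mul0r // => v vp; rewrite big_seq big1 // => w wq.
    have [/(_ _ vp) [_ pv] _ _ _] := hvt _ pP; have [/(_ _ wq) [_ qw] _ _ _] := hvt _ qP.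
    have vp' : star v * p = star v by rewrite -[LHS]sK sM sK (hP _ pP).2 pv.
    by rewrite /blk -vp' -qw !mulrA -(mulrA (star v)) -(mulrA (star v)) pxq mulr0 mul0r eqxx.
  rewrite /V big_flatten big_map mulr_suml big_seq [X in _ <= X]big_seq.
  apply: ler_sum => p pP.
  under eq_bigr do rewrite big_flatten big_map.
  rewrite exchange_big mulr_suml big_seq [X in _ <= X]big_seq.
  by apply: ler_sum => q qP; exact: inner.
have meps : m%:R * eps <= 1 by rewrite -[X in _ <= X]tr_ts lerDl.
have meps' : 1 <= m%:R * eps + s * eps by rewrite -[X in X <= _]tr_ts lerD2l.
have Zle : (size Z)%:R * eps ^+ 2 <= I + N * (2 * s * eps + s ^+ 2 * eps ^+ 2).
  have -> : N * (2 * s * eps + s ^+ 2 * eps ^+ 2) =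
      \sum_(x <- X) (2 * s * eps + s ^+ 2 * eps ^+ 2).
    by rewrite sum_cst.
  rewrite sizeZ mulr_suml /I -big_split; apply: ler_sum => x _ /=.
  rewrite /ts big_cat /=.
  under eq_bigr do rewrite big_cat; under [X in _ + X]eq_bigr do rewrite big_cat.
  rewrite !big_split /=.
  (* The [2 * m * s + s ^+ 2] entries touching a remainder are all counted as nonzero;
     [m * eps <= 1] turns this into the stated error. *)
  have := VV x; have := sum_blk_le x V T; have := sum_blk_le x T V; have := sum_blk_le x T T.
  rewrite sT -/m -/s.
  move: (\sum_(v <- V) \sum_(w <- V) _) (\sum_(v <- V) \sum_(w <- T) _)
        (\sum_(v <- T) \sum_(w <- V) _) (\sum_(v <- T) \sum_(w <- T) _) => a b c d.
  move: (m%:R : R) meps => mr meps h1 h2 h3 h4.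
  have e2 : 0 <= eps ^+ 2 by exact: sqr_ge0.
  have : b * eps ^+ 2 <= mr * s * eps ^+ 2 by exact: ler_wpM2r.
  have : c * eps ^+ 2 <= s * mr * eps ^+ 2 by exact: ler_wpM2r.
  have : d * eps ^+ 2 <= s * s * eps ^+ 2 by exact: ler_wpM2r.
  have : mr * eps * (s * eps) <= 1 * (s * eps)
    by apply: ler_wpM2r => //; rewrite mulr_ge0 // ltW.
  by rewrite !expr2; lra.
have nr1 : 1 <= nr by rewrite /nr ler1n.
have [mr0 Zm] := slot_estimate I0 N0 s0 nr1 eps0 e1 eK meps meps' Zle.
have m0 : (0 < m)%N by rewrite -(ltr0n R).
have Zn : (size Z <= size (slots n m))%N.
  rewrite -(leq_pmul2l (isT : 0 < 2)%N) size_slots -(ler_nat R) !natrM -/nr.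
  have -> // : (m.-1)%:R * (m.-2)%:R = (m%:R - 1) * (m%:R - 2) :> R.
  case: (m) m0 => [|[|k]] // _; first by rewrite subrr !mul0r.
  by rewrite /= -(natrB _ (isT : 1 <= k.+2)%N) -(natrB _ (isT : 2 <= k.+2)%N) subn1 subn2.
exists (generator star t M m n Z); split.
  by move=> c; exact: (generator_selfadjoint hA).
move=> B hB Bg x xX.
have tt i j : (i < M)%N -> (j < M)%N -> i != j -> star (t i) * t j = 0.
  exact: partition_orth.
apply: (generators_generate hA (e := e) (t := t) (M := M) (m := m) (n := n) (Z := Z)) => //.
  by rewrite MmP leq_addr.
move=> j k jM kM nz; rewrite mem_filter nz /=; apply/allpairsP; exists (x, (t j, t k)).
by split=> //=; apply/allpairsP; exists (t j, t k); split=> //=; exact: tts.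
Qed.

End Counting.

(** * A von Neumann algebra as an algebra type, and its trace *)

Section Carrier.
Context {R : realType} {H : completeNormedModType R[i]}.
Variables (dot : {dot H for (@Num.conj R[i])}) (M : set (H -> H)).
Hypotheses (hM : vonNeumann_algebra dot M).
Hypothesis id_neq0 : (idfun : H -> H) <> (fun=> 0).

(* The hypotheses are phantom arguments, on which the instances below depend. *)
Definition vn_carrier of vonNeumann_algebra dot M
  & (idfun : H -> H) <> (fun=> 0) := {x : H -> H | M x}.
Local Notation T := (vn_carrier hM id_neq0).
Implicit Types (x y z : T).

Definition vn_val x : H -> H := proj1_sig x.

Lemma vn_inj x y : vn_val x = vn_val y -> x = y.
Proof.
case: x y => [x hx] [y hy]; rewrite /vn_val /= => xy; move: hx; rewrite xy => hx.
by congr exist; exact: Prop_irrelevance.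
Qed.

Let hw : weakly_closed_star_algebra dot M. Proof. by case: hM. Qed.

Lemma vn_linear x : linear (vn_val x).
Proof. by have [] := wcsa_bounded hw (proj2_sig x). Qed.

Lemma vnP x : M (vn_val x). Proof. by case: x. Qed.

Lemma vn_addP x y : M (vn_val x + vn_val y).
Proof. by rewrite -[vn_val x]scale1r; apply: (wcsa_linear hw); exact: vnP. Qed.

Lemma vn_scaleP (a : R[i]) x : M (a *: vn_val x).
Proof.
by rewrite -[_ *: _]addr0; apply: (wcsa_linear hw); [exact: vnP | exact: wcsa_zero hw].
Qed.

Lemma vn_oppP x : M (- vn_val x).
Proof. by rewrite -scaleN1r; exact: vn_scaleP. Qed.

Lemma vn_mulP x y : M (vn_val x \o vn_val y).
Proof. by apply: (wcsa_mul hw); exact: vnP. Qed.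

Lemma vn_adjP x : M (adj dot (vn_val x)).
Proof. by apply: (wcsa_adj hw); exact: vnP. Qed.

Definition vn_zero : T := exist M _ (wcsa_zero hw).
Definition vn_one : T := exist M _ (proj2 hM).
Definition vn_add x y : T := exist M _ (vn_addP x y).
Definition vn_opp x : T := exist M _ (vn_oppP x).
Definition vn_scale (a : R[i]) x : T := exist M _ (vn_scaleP a x).
Definition vn_mul x y : T := exist M _ (vn_mulP x y).
Definition vn_star x : T := exist M _ (vn_adjP x).

HB.instance Definition _ := gen_eqMixin T.
HB.instance Definition _ := gen_choiceMixin T.

Let vn_addA : associative vn_add.
Proof. by move=> x y z; apply: vn_inj; exact: addrA. Qed.
Let vn_addC : commutative vn_add.
Proof. by move=> x y; apply: vn_inj; exact: addrC. Qed.
Let vn_add0 : left_id vn_zero vn_add.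
Proof. by move=> x; apply: vn_inj; exact: add0r. Qed.
Let vn_addN : left_inverse vn_zero vn_opp vn_add.
Proof. by move=> x; apply: vn_inj; exact: addNr. Qed.
HB.instance Definition _ := GRing.isZmodule.Build T vn_addA vn_addC vn_add0 vn_addN.

Let vn_mulA : associative vn_mul.
Proof. by move=> x y z; apply: vn_inj. Qed.
Let vn_mul1 : left_id vn_one vn_mul.
Proof. by move=> x; apply: vn_inj. Qed.
Let vn_mulr1 : right_id vn_one vn_mul.
Proof. by move=> x; apply: vn_inj. Qed.
Let vn_mulDl : left_distributive vn_mul vn_add.
Proof. by move=> x y z; apply: vn_inj. Qed.
Let vn_mulDr : right_distributive vn_mul vn_add.
Proof.
move=> x y z; apply: vn_inj; apply/funext => u /=.
by have := vn_linear x 1 (vn_val y u) (vn_val z u); rewrite !scale1r.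
Qed.
Let vn_one_neq0 : vn_one != vn_zero.
Proof. by apply/eqP => /(congr1 vn_val). Qed.
HB.instance Definition _ := GRing.Zmodule_isNzRing.Build T
  vn_mulA vn_mul1 vn_mulr1 vn_mulDl vn_mulDr vn_one_neq0.

Let vn_scaleA (a b : R[i]) x : vn_scale a (vn_scale b x) = vn_scale (a * b) x.
Proof. by apply: vn_inj; exact: scalerA. Qed.
Let vn_scale1 : left_id 1 vn_scale.
Proof. by move=> x; apply: vn_inj; exact: scale1r. Qed.
Let vn_scaleDr : right_distributive vn_scale +%R.
Proof. by move=> a x y; apply: vn_inj; exact: scalerDr. Qed.
Let vn_scaleDl x : {morph vn_scale^~ x : a b / a + b}.
Proof. by move=> a b; apply: vn_inj; exact: scalerDl. Qed.
HB.instance Definition _ := GRing.Zmodule_isLmodule.Build R[i] T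
  vn_scaleA vn_scale1 vn_scaleDr vn_scaleDl.

Let vn_scaleAl (a : R[i]) (x y : T) : a *: (x * y) = a *: x * y.
Proof. by apply: vn_inj. Qed.
HB.instance Definition _ := GRing.Lmodule_isLalgebra.Build R[i] T vn_scaleAl.

Let vn_scaleAr (a : R[i]) (x y : T) : a *: (x * y) = x * (a *: y).
Proof.
apply: vn_inj; apply/funext => u /=.
have h := vn_linear x; have := h a (vn_val y u) 0.
have := h (-1) 0 0; rewrite scaler0 addr0 scaleN1r addNr => ->.
by rewrite !addr0; exact: esym.
Qed.
HB.instance Definition _ := GRing.Lalgebra_isAlgebra.Build R[i] T vn_scaleAr.

Hypothesis hH : hilbert_space dot.

Lemma vn_star_rep : star_rep dot (vn_val : T -> H -> H) vn_star.
Proof.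
have bd x : bounded_op (vn_val x) by apply: (wcsa_bounded hw); exact: vnP.
split=> //.
- exact: vn_linear.
- by move=> x y xy; apply: vn_inj; exact/funext.
- by move=> x u w; exact: (adj_is_adjoint hH (bd x)).
- by move=> x; exact: (bounded_op_nsq hH (bd x)).
- move=> s y sle lim; have My : M y.
    by apply: (wot_closed_slim hH hw _ sle lim) => n; exact: vnP.
  by exists (exist M y My).
Qed.

End Carrier.

Section Trace.
Context {R : realType} {H : completeNormedModType R[i]}.
Variables (dot : {dot H for (@Num.conj R[i])}) (M : set (H -> H)).
Variable tau : (H -> H) -> R[i].
Hypotheses (hM : vonNeumann_algebra dot M) (id_neq0 : (idfun : H -> H) <> (fun=> 0)).
Hypotheses (hH : hilbert_space dot) (hII : II1_factor dot M).
Hypothesis htau : faithful_normal_tracial_state dot M tau.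
Local Notation T := (vn_carrier hM id_neq0).

Definition vn_tr (x : T) : R := rtr tau (vn_val x).

Lemma vn_proj (p : T) : proj (@vn_star _ _ _ _ hM id_neq0) p <-> projection dot (vn_val p).
Proof.
split=> [[pp sp]|[_ pp sp]].
  split; [exact: (wcsa_bounded (proj1 hM) (vnP p))
         | exact: (congr1 (@vn_val _ _ _ _ _ _) pp) |].
  exact: (congr1 (@vn_val _ _ _ _ _ _) sp).
by split; exact: vn_inj.
Qed.

Lemma vn_tracial_factor : tracial_factor (@vn_star _ _ _ _ hM id_neq0) vn_tr.
Proof.
have [[_ _ ctr] _ nab] := hII.
split.
- move=> x y; have := tr_linear htau 1 (vnP x) (vnP y).
  by rewrite scale1r mul1r => E; rewrite /vn_tr /rtr -raddfD -E.
- by move=> x y; rewrite /vn_tr /rtr -(tr_tracial htau) //; exact: vnP.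
- by move=> x; have := tr_positive htau (vnP x); rewrite lecE => /andP[_].
- move=> x h; apply: vn_inj; apply: (tr_faithful htau); first exact: vnP.
  (* A nonnegative element of [R[i]] equals its real part, so faithfulness survives the passage to
     [vn_tr]. *)
  by rewrite [LHS]ge0_Re ?(tr_positive htau (vnP x)) // [complex.Re _]h.
- by rewrite /vn_tr /rtr (tr_unit htau).
- move=> x h; have [|a xa] := ctr _ (vnP x).
    by move=> y My; exact: (congr1 (@vn_val _ _ _ _ _ _) (h (exist M y My))).
  by exists a; apply: vn_inj.
- move=> p /vn_proj hp h; apply: vn_inj; apply: nab => //; first exact: vnP.
  move=> x y Mx My.
  exact: (congr1 (@vn_val _ _ _ _ _ _) (h (exist M x Mx) (exist M y My))).
Qed.

End Trace.

Lemma finite_set_uniq (T : choiceType) (A : set T) : finite_set A ->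
  exists2 s : seq T, uniq s & A = [set` s].
Proof.
move=> /finite_seqP[s ->]; exists (undup s); first exact: undup_uniq.
by apply/seteqP; split=> x /=; rewrite mem_undup.
Qed.

Theorem theorem3p1 (R : realType) (H : completeNormedModType R[i])
    (dot : {dot H for (@Num.conj R[i])}) (M : set (H -> H))
    (tau : (H -> H) -> R[i]) (n : nat) :
  hilbert_space dot ->
  II1_factor dot M ->
  separable_vN dot M ->
  faithful_normal_tracial_state dot M tau ->
  (generator_invariant dot M tau < (n%:R / 2)%:E)%E ->
  exists h : 'I_n.+1 -> H -> H,
    (forall k, M (h k) /\ selfadjoint dot (h k)) /\
    Wstar dot (range h) = M.
Proof.
move=> hH hII _ htau.
have [[hM id0 _] _ _] := hII; have [hw M1] := hM.
pose T := vn_carrier hM id0.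
pose star : T -> T := @vn_star _ _ _ _ hM id0.
pose tr : T -> R := @vn_tr _ _ _ _ tau hM id0.
have hA : star_rep dot (@vn_val _ _ _ _ hM id0) star := vn_star_rep hM id0 hH.
have hT : tracial_factor star tr := vn_tracial_factor hM id0 hII htau.
move=> /ereal_inf_lt [_ [X [finX XM WX] <-]] /ereal_inf_lt [_ [P [finP PM Porth P1] <-]].
rewrite lte_fin => hI.
have [Xl uX XE] := finite_set_uniq finX; have [Pl uP PE] := finite_set_uniq finP.
pose val : T -> H -> H := @vn_val _ _ _ _ hM id0.
(* The default 0 is harmless, since [emb] is only evaluated on elements of [M]. *)
pose emb (x : H -> H) : T := if pselect (M x) is left h then exist M x h else 0.
have embK x : M x -> val (emb x) = x.
  by rewrite /emb; case: pselect => // h _.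
have inP p : p \in Pl -> M p /\ projection dot p.
  by move=> pP; apply: PM; rewrite PE.
have inX x : x \in Xl -> M x by move=> xX; apply: XM; rewrite XE.
have val_sum (r : seq T) : val (\sum_(p <- r) p) = \sum_(p <- r) val p.
  by apply: (big_morph val).
have hP p : p \in [seq emb p | p <- Pl] -> proj star p.
  by case/mapP => q /inP [Mq pq] ->; apply/vn_proj; rewrite [vn_val _]embK.
have Ps1 : \sum_(p <- [seq emb p | p <- Pl]) p = 1.
  apply: vn_inj; rewrite [LHS]val_sum big_map -[RHS]P1 PE -fsbig_seq //.
  by rewrite big_seq [RHS]big_seq; apply: eq_bigr => p /inP [Mp _]; rewrite embK.
have hIs : intersection_sum tr [seq emb x | x <- Xl] [seq emb p | p <- Pl] < n%:R / 2.
  apply: le_lt_trans hI; rewrite /Ipart XE -fsbig_seq // /intersection_sum big_map.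
  rewrite big_seq [X in _ <= X]big_seq; apply: ler_sum => x /inX Mx.
  rewrite big_map; under eq_bigr do rewrite big_map.
  rewrite /Ielt PE.
  pose r := [seq pq <- [seq (p, q) | p <- Pl, q <- Pl] |
             emb pq.1 * emb x * emb pq.2 != 0].
  rewrite (_ : [set pq | _] = [set` r]); last first.
    have mulE p q : M p -> M q -> p \o x \o q = val (emb p * emb x * emb q).
      by move=> Mp Mq; rewrite -{1}(embK _ Mp) -{1}(embK _ Mx) -{1}(embK _ Mq).
    apply/seteqP; split=> -[p q] /=.
      move=> [/= pP qP pxq]; rewrite mem_filter /=; apply/andP; split.
        apply/eqP => pxq0; apply: pxq.
        by rewrite mulE ?pxq0 //; [have [] := inP _ pP | have [] := inP _ qP].
      by apply/allpairsP; exists (p, q).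
    rewrite mem_filter /= => /andP[/eqP pxq /allpairsP[[p' q'] /= [pP qP [pE qE]]]].
    rewrite pE qE in pxq *; split=> // pxq0; apply: pxq; apply: vn_inj.
    by rewrite -[LHS]mulE ?pxq0 //; [have [] := inP _ pP | have [] := inP _ qP].
  rewrite -fsbig_seq; last first.
    by rewrite filter_uniq // allpairs_uniq // => -[p q] [p' q'] _ _ [-> ->].
  rewrite /r big_filter [X in _ <= X]big_mkcond big_allpairs /= big_seq [X in _ <= X]big_seq.
  apply: ler_sum => p /inP [Mp _]; rewrite big_seq [X in _ <= X]big_seq.
  apply: ler_sum => q /inP [Mq _]; case: ifP => // _.
  by rewrite /tr /vn_tr ![vn_val _]embK.
have [h [hsa hgen]] := few_generators hH hA hT hP Ps1 hIs.
exists (fun k => val (h k)); split.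
  by move=> k; split; [exact: vnP | exact: (congr1 (@vn_val _ _ _ _ hM id0) (hsa k))].
rewrite eqEsubset; split.
  move=> x; apply; split; first exact: hw.
  by move=> _ [k _ <-]; exact: vnP.
(* A weakly closed algebra [B] containing the [h k] contains [X], hence [Wstar X], which is [M]. For
   the first inclusion, [few_generators] is applied to the elements of [T] whose operator lies in
   [B]. *)
rewrite -[X in X `<=` _]WX => x hx B [hB hBh]; apply: hx; split=> // y Xy.
have My := XM _ Xy; rewrite -(embK _ My).
apply: (hgen [set z | B (val z)]); last first.
- by apply: map_f; move: Xy; rewrite XE.
- move=> c cn; apply: hBh; exists (Ordinal (cn : (c < n.+1)%N)) => //.
split.
- by move=> a z z' Bz Bz'; exact: (wcsa_linear hB).
- by move=> z z' Bz Bz'; exact: (wcsa_mul hB).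
- by move=> z Bz; exact: (wcsa_adj hB).
- exact: (wcsa_zero hB).
Qed.
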